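(* Assume the following hypothesis $(\mathrm{H}_3)$: for every $n\ge3$, every $\rho\in[-1,0]$ and every measurable $f:\mathbb{R}^n\to B^3$, $\mathrm{Stab}_\rho[f]\ge\mathrm{Stab}_\rho[f^{(3)}_{\mathrm{opt}}]$, where $f^{(3)}_{\mathrm{opt}}(x)=(x_1,x_2,x_3)/\|(x_1,x_2,x_3)\|$. Then \[\inf_G\frac{\mathrm{Prod}(G)}{\mathrm{SDP}_{\mathrm{Prod}}(G)}=\alpha_{\mathrm{BOV}},\] the infimum being over all weighted graphs $G$.
   Context: $\mathbf{x}\sim_\rho\mathbf{y}$ are $\rho$-correlated standard Gaussian vectors in $\mathbb{R}^n$ and $\mathrm{Stab}_\rho[f]=\mathbb{E}\langle f(\mathbf{x}),f(\mathbf{y})\rangle$. A weighted graph $G=(V,E,w)$ is a finite undirected graph with nonnegative edge weights summing to $1$; $(\mathbf{u},\mathbf{v})\sim E$ is a random edge. $\mathrm{Prod}(G)=\max_{f:V\to S^2}\mathbb{E}[\tfrac14-\tfrac14\langle f(\mathbf{u}),f(\mathbf{v})\rangle]$ and $\mathrm{SDP}_{\mathrm{Prod}}(G)=\max_{f:V\to S^{|V|-1}}\mathbb{E}[\tfrac14-\tfrac14\langle f(\mathbf{u}),f(\mathbf{v})\rangle]$. $F^*(k,\rho)=\mathbb{E}\langle\mathbf{Z}u/\|\mathbf{Z}u\|,\mathbf{Z}v/\|\mathbf{Z}v\|\rangle$ for unit $u,v$ with $\langle u,v\rangle=\rho$ and $\mathbf{Z}$ a $k\times m$ standard Gaussian matrix;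 $\alpha_{\mathrm{BOV}}=\min_{-1\le\rho<1}\frac{1-F^*(3,\rho)}{1-\rho}$. *)

(* Defs.v *)
From HB Require Import structures.
From mathcomp Require Import all_boot all_order all_algebra.
From mathcomp Require Import all_classical all_reals all_analysis.
Set Implicit Arguments.
Unset Strict Implicit.
Unset Printing Implicit Defensive.
Import Order.TTheory GRing.Theory Num.Theory.
Local Open Scope classical_set_scope.
Local Open Scope ring_scope.

Section Defs.
Context {R : realType}.

(* Vectors of R^n are represented as n-tuples (the tuple type carries the
   product sigma-algebra generated by the coordinates, i.e. the Borel
   sigma-algebra of R^n). *)

Definition dotv {n : nat} (u v : n.-tuple R) : R :=
  \sum_(i < n) tnth u i * tnth v i.

Definition normv {n : nat} (u : n.-tuple R) : R := Num.sqrt (dotv u u).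

Definition lincomb {n : nat} (a : R) (x : n.-tuple R) (b : R) (y : n.-tuple R)
  : n.-tuple R := [tuple a * tnth x i + b * tnth y i | i < n].

(* x / ||x||  (the zero vector is sent to 0; a null set, irrelevant). *)
Definition normalize {n : nat} (x : n.-tuple R) : n.-tuple R :=
  [tuple tnth x i / normv x | i < n].

(* E[g(x)] for x a standard Gaussian vector in R^n: integral with respect to
   the n-fold product of the standard normal law N(0,1), computed as an
   iterated integral over the coordinates. *)
Fixpoint gauss_exp (n : nat) : (n.-tuple R -> R) -> R :=
  match n with
  | 0 => fun g => g [tuple]
  | n'.+1 => fun g =>
      Rintegral (normal_prob 0 1) [set: R]
        (fun t : R => @gauss_exp n' (fun x => g (cons_tuple t x)))
  end.

(* Stab_rho[f] = E <f(x), f(y)> for x ~_rho y standard Gaussian vectors in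
   R^n, realised as y = rho x + sqrt(1 - rho^2) z with x, z independent. *)
Definition Stab (n : nat) (rho : R) (f : n.-tuple R -> 3.-tuple R) : R :=
  @gauss_exp n (fun x => @gauss_exp n (fun z =>
     dotv (f x) (f (lincomb rho x (Num.sqrt (1 - rho ^+ 2)) z)))).

Definition fopt3 (n : nat) (x : n.-tuple R) : 3.-tuple R :=
  normalize [tuple nth 0 x i | i < 3].

Definition H3 : Prop :=
  forall (n : nat), (3 <= n)%N ->
  forall rho : R, -1 <= rho <= 0 ->
  forall f : n.-tuple R -> 3.-tuple R,
    measurable_fun [set: n.-tuple R] f ->
    (forall x, normv (f x) <= 1) ->
    Stab rho (@fopt3 n) <= Stab rho f.

(* F^*(k, rho) = E < Zu/||Zu||, Zv/||Zv|| >, with Z a k x m standard Gaussian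
   matrix and unit u, v with <u,v> = rho.  (The value does not depend on m nor
   on the choice of u, v; we take m = 2, u = e_1,
   v = rho e_1 + sqrt(1-rho^2) e_2, so Z = [c1 c2] with independent standard
   Gaussian columns c1, c2 in R^k, Zu = c1, Zv = rho c1 + sqrt(1-rho^2) c2.) *)
Definition Fstar (k : nat) (rho : R) : R :=
  @gauss_exp k (fun c1 => @gauss_exp k (fun c2 =>
    let Zu := lincomb 1 c1 0 c2 in
    let Zv := lincomb rho c1 (Num.sqrt (1 - rho ^+ 2)) c2 in
    dotv (normalize Zu) (normalize Zv))).

Definition alpha_BOV : R :=
  inf [set (1 - Fstar 3 rho) / (1 - rho) | rho in [set rho : R | -1 <= rho < 1]].

(* A weighted graph on a finite vertex set V: an undirected simple graph with
   nonnegative edge weights summing to 1.  It is encoded by the law of the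
   random (ordered) edge (u,v) ~ E: w u v >= 0, w symmetric, no loops, and
   sum over ordered pairs equal to 1 (edge {u,v} has weight w u v + w v u). *)
Record wgraph (V : finType) := WGraph {
  wt : V -> V -> R;
  wt_ge0 : forall u v, 0 <= wt u v;
  wt_sym : forall u v, wt u v = wt v u;
  wt_noloop : forall u, wt u u = 0;
  wt_sum1 : \sum_(u : V) \sum_(v : V) wt u v = 1
}.

Definition prod_val (V : finType) (G : wgraph V) (d : nat) (f : V -> d.-tuple R)
  : R :=
  \sum_(u : V) \sum_(v : V) wt G u v * (4^-1 - 4^-1 * dotv (f u) (f v)).

Definition Prod (V : finType) (G : wgraph V) : R :=
  sup [set prod_val G f | f in [set f : V -> 3.-tuple R |
                                   forall v, normv (f v) = 1]].

Definition SDP_Prod (V : finType) (G : wgraph V) : R :=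
  sup [set prod_val G f | f in [set f : V -> #|V|.-tuple R |
                                   forall v, normv (f v) = 1]].

Definition ratios : set R :=
  [set r | exists (V : finType) (G : wgraph V), r = Prod G / SDP_Prod G].

End Defs.

(* Main.v *)
(**
Lower bound. Round an SDP solution g : V -> S^(m-1) to v |-> Z g(v) / ||Z g(v)||
with Z a 3 x m Gaussian matrix. By rotation invariance, an edge (u, v) then
contributes (1 - Fstar 3 <g u, g v>) / 4 on average, which is at least
alpha_BOV * (1 - <g u, g v>) / 4. Rotation invariance is reduced to the plane,
where a rotation is a product of three shears, each preserving Lebesgue measure.

Upper bound, rho in [-1, 0]. Quantize each coordinate of R^n and let G be the
joint law of the cells of two rho-correlated Gaussian vectors. An assignment
V -> S^2 is a function constant on cells, so H3 bounds Prod G by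
(1 - Fstar 3 rho) / 4, whereas by concentration of the norm the normalized
quantized vectors form an SDP solution of value close to (1 - rho) / 4. Loops
have objective 0 at unit vectors, so deleting them and renormalizing does not
change the ratio.

Upper bound, rho in (0, 1). Here Fstar 3 rho <= rho, so the quotient defining
alpha_BOV is at least 1, and the case rho = 0 already bounds the infimum by 1.
The inequality is Gebelein's, applied to smoothed coordinates of x / ||x||: for
a centered Lipschitz h the noise stability S satisfies S(r)^2 <= S(1) S(r^2) and
S(r) = O(r), and iterating the former turns the latter into S(r) <= r S(1).
*)

Require Import Defs.
From HB Require Import structures.
From mathcomp Require Import all_boot all_order all_algebra.
From mathcomp Require Import all_classical all_reals all_analysis.
From mathcomp Require Import measurable_realfun ring lra.
Set Implicit Arguments.
Unset Strict Implicit.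
Unset Printing Implicit Defensive.
Import Order.TTheory GRing.Theory Num.Theory.
Import numFieldNormedType.Exports.
Local Open Scope classical_set_scope.
Local Open Scope ring_scope.

Notation "'\E' P f" := (Rintegral P [set: _] f)
  (at level 10, P at level 9, f at level 9).

Section bounded_measurable.
Context {R : realType} d (T : measurableType d).
Implicit Types f g : T -> R.

Definition bmeas f : Prop :=
  measurable_fun [set: T] f /\ exists M, forall x, `|f x| <= M.

Lemma bmeas_measurable f : bmeas f -> measurable_fun [set: T] f.
Proof. by case. Qed.

Lemma bmeas_cst (c : R) : bmeas (fun=> c).
Proof. by split; [exact: measurable_cst|exists `|c|]. Qed.

Lemma bmeasD f g : bmeas f -> bmeas g -> bmeas (fun x => f x + g x).
Proof.
move=> [mf [M fM]] [mg [N gN]]; split; first exact: measurable_funD.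
by exists (M + N) => x; rewrite (le_trans (ler_normD _ _))// lerD.
Qed.

Lemma bmeasM f g : bmeas f -> bmeas g -> bmeas (fun x => f x * g x).
Proof.
move=> [mf [M fM]] [mg [N gN]]; split; first exact: measurable_funM.
by exists (M * N) => x; rewrite normrM ler_pM.
Qed.

Lemma bmeasZ (c : R) f : bmeas f -> bmeas (fun x => c * f x).
Proof. exact/bmeasM/bmeas_cst. Qed.

Lemma bmeasB f g : bmeas f -> bmeas g -> bmeas (fun x => f x - g x).
Proof.
move=> bf bg; apply: bmeasD => //.
by under eq_fun do rewrite -mulN1r; exact: bmeasZ.
Qed.

Lemma bmeasX f n : bmeas f -> bmeas (fun x => f x ^+ n).
Proof.
move=> bf; elim: n => [|n IH]; first exact: bmeas_cst.
by under eq_fun do rewrite exprS; exact: bmeasM.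
Qed.

Lemma bmeas_sum I (r : seq I) (F : I -> T -> R) :
  (forall i, bmeas (F i)) -> bmeas (fun x => \sum_(i <- r) F i x).
Proof.
move=> bF; elim: r => [|i r IH].
  by under eq_fun do rewrite big_nil; exact: bmeas_cst.
by under eq_fun do rewrite big_cons; exact: bmeasD.
Qed.

Lemma bmeas_integrable (P : probability T R) f :
  bmeas f -> P.-integrable [set: T] (EFin \o f).
Proof.
move=> [mf [M fM]]; apply: measurable_bounded_integrable => //.
- by rewrite (le_lt_trans (probability_le1 P measurableT))// ltry.
- exists M; split; first exact: num_real.
  by move=> y My x _; exact: le_trans (fM x) (ltW My).
Qed.

End bounded_measurable.

Lemma bmeas_comp {R : realType} d d' (T : measurableType d)
    (T' : measurableType d') (f : T' -> R) (phi : T -> T') :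
  bmeas f -> measurable_fun [set: T] phi -> bmeas (fun x => f (phi x)).
Proof.
by move=> [mf [M fM]] mphi; split; [exact: measurableT_comp|exists M].
Qed.

Section expectation.
Context {R : realType} d (T : measurableType d) (P : probability T R).
Implicit Types f g : T -> R.

Lemma expect_cst (c : R) : \E P (fun=> c) = c.
Proof.
by rewrite Rintegral_cst// -[X in fine X]/(P [set: T]) probability_setT mulr1.
Qed.

Lemma eq_expect f g : f =1 g -> \E P f = \E P g.
Proof. by move=> fg; apply: eq_Rintegral => x _. Qed.

Lemma expectD f g : bmeas f -> bmeas g ->
  \E P (fun x => f x + g x) = \E P f + \E P g.
Proof. by move=> bf bg; apply: RintegralD => //; exact: bmeas_integrable. Qed.

Lemma expectB f g : bmeas f -> bmeas g ->
  \E P (fun x => f x - g x) = \E P f - \E P g.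
Proof. by move=> bf bg; apply: RintegralB => //; exact: bmeas_integrable. Qed.

Lemma expectZ (c : R) f : bmeas f -> \E P (fun x => c * f x) = c * \E P f.
Proof. by move=> bf; apply: RintegralZl => //; exact: bmeas_integrable. Qed.

Lemma expect_sum I (r : seq I) (F : I -> T -> R) : (forall i, bmeas (F i)) ->
  \E P (fun x => \sum_(i <- r) F i x) = \sum_(i <- r) \E P (F i).
Proof.
move=> bF; elim: r => [|i r IH].
  by under eq_expect do rewrite big_nil; rewrite expect_cst big_nil.
under eq_expect do rewrite big_cons.
by rewrite expectD//; [rewrite IH big_cons|exact: bmeas_sum].
Qed.

Lemma expect_ge0 f : (forall x, 0 <= f x) -> 0 <= \E P f.
Proof. by move=> f0; apply: Rintegral_ge0. Qed.

Lemma le_expect f g : bmeas f -> bmeas g -> (forall x, f x <= g x) ->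
  \E P f <= \E P g.
Proof.
by move=> bf bg fg; apply: le_Rintegral => //; exact: bmeas_integrable.
Qed.

Lemma norm_expect_le f (M : R) : measurable_fun [set: T] f ->
  (forall x, `|f x| <= M) -> `|\E P f| <= M.
Proof.
move=> mf fM; have bf : bmeas f by split=> //; exists M.
rewrite (le_trans (le_normr_Rintegral _ (bmeas_integrable P bf)))//.
rewrite -(expect_cst M); apply: (le_expect _ (bmeas_cst _ _) fM).
by split; [exact: measurableT_comp|exists M => x; rewrite normr_id].
Qed.

Lemma expect_gt0 f : P.-integrable [set: T] (EFin \o f) ->
  (forall x, 0 <= f x) -> {ae P, forall x, f x != 0} -> 0 < \E P f.
Proof.
move=> fi f0 fn0; rewrite lt_neqAle eq_sym expect_ge0// andbT.
apply/negP => /eqP Ef0.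
have mf : measurable_fun [set: T] (EFin \o f) := measurable_int _ fi.
have /(ae_eq_integral_abs _ measurableT mf) f_ae0 :
    (\int[P]_x `|(EFin \o f) x| = 0)%E.
  under eq_integral do rewrite gee0_abs ?lee_fin//.
  by rewrite -[LHS]fineK ?[fine _]Ef0// (integrable_fin_num measurableT fi).
have [N [mN N0 /(_ _ _)Nall]] : {ae P, forall x : T, False}.
  by apply: filterS2 fn0 f_ae0 => x /eqP fx0 /(_ I)[].
have : P [set: T] = 0 :> \bar R.
  by rewrite -[RHS]N0; congr (P _); apply/seteqP; split=> // x _; exact: Nall.
by move/eqP; rewrite probability_setT eqe oner_eq0.
Qed.

Lemma exists_ge_expect f : bmeas f -> exists x, \E P f <= f x.
Proof.
move=> bf; apply: contrapT => /forallNP nf.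
have lt x : 0 < \E P f - f x by rewrite subr_gt0 ltNge; apply/negP/nf.
have bg : bmeas (fun x => \E P f - f x).
  by apply: bmeasB => //; exact: bmeas_cst.
have : 0 < \E P (fun x => \E P f - f x).
  apply: expect_gt0; first exact: bmeas_integrable.
  - by move=> x; exact: ltW.
  - by apply: aeW => x; rewrite gt_eqF.
by rewrite expectB ?expect_cst ?subrr ?ltxx//; exact: bmeas_cst.
Qed.

Lemma expect_cauchy_schwarz f g : bmeas f -> bmeas g ->
  \E P (fun x => f x * g x) ^+ 2 <=
  \E P (fun x => f x ^+ 2) * \E P (fun x => g x ^+ 2).
Proof.
move=> bf bg; set B := \E P _; set A := \E P _; set C := \E P _.
pose p := Poly [:: C; 2 * B; A].
have pge0 r : 0 <= p.[r].
  suff -> : p.[r] = \E P (fun x => (r * f x + g x) ^+ 2).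
    by apply: expect_ge0 => x; exact: sqr_ge0.
  have -> : p.[r] = r ^+ 2 * A + 2 * r * B + C by rewrite horner_Poly /=; ring.
  have bff := bmeasX 2 bf; have bgg := bmeasX 2 bg; have bfg := bmeasM bf bg.
  rewrite -!expectZ// -!expectD//; do ?[exact: bmeasZ|apply: bmeasD].
  by apply: eq_expect => x; ring.
have size_p : (size p <= 3)%N := size_Poly _.
by have := deg_le2_poly_ge0 size_p pge0; rewrite !coefE /=; lra.
Qed.

Lemma expect_dominated (F : nat -> T -> R) f g :
  (forall n, measurable_fun [set: T] (F n)) -> measurable_fun [set: T] f ->
  P.-integrable [set: T] (EFin \o g) ->
  (forall n x, `|F n x| <= g x) -> (forall x, F n x @[n --> \oo] --> f x) ->
  \E P (F n) @[n --> \oo] --> \E P f.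
Proof.
move=> mF mf ig Fg Ff.
have [] := @dominated_convergence _ T R P setT measurableT
    (fun n => EFin \o F n) (EFin \o f) (EFin \o g).
- by move=> n; exact/measurable_EFinP.
- exact/measurable_EFinP.
- by apply: aeW => x _; apply: cvg_EFin; [exact: nearW|exact: Ff].
- exact: ig.
- by apply: aeW => x n _; rewrite lee_fin Fg.
move=> fi _ cv; apply: fine_cvg; rewrite fineK//.
exact: integrable_fin_num fi.
Qed.

End expectation.

Section iterated_expectation.
Context {R : realType} d d' (T : measurableType d) (T' : measurableType d').
Variables (P : probability T R) (Q : probability T' R).
Implicit Type f : T * T' -> R.

Lemma bmeas_section1 f x : bmeas f -> bmeas (fun y => f (x, y)).
Proof. by move=> bf; apply: (bmeas_comp bf); exact: pair1_measurable. Qed.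

Lemma bmeas_section2 f y : bmeas f -> bmeas (fun x => f (x, y)).
Proof. by move=> bf; apply: (bmeas_comp bf); exact: pair2_measurable. Qed.

Lemma expect_prod f : bmeas f ->
  \E (P \x Q)%E f = \E P (fun x => \E Q (fun y => f (x, y))).
Proof.
move=> bf; rewrite /Rintegral -integral12_prod_meas1;
  last exact: bmeas_integrable.
congr fine; apply: eq_integral => x _; rewrite fineK//.
exact: integrable_fin_num (bmeas_integrable Q (bmeas_section1 x bf)).
Qed.

Lemma expect_prod21 f : bmeas f ->
  \E (P \x Q)%E f = \E Q (fun y => \E P (fun x => f (x, y))).
Proof.
move=> bf; rewrite /Rintegral -integral21_prod_meas1;
  last exact: bmeas_integrable.
congr fine; apply: eq_integral => y _; rewrite fineK//.
exact: integrable_fin_num (bmeas_integrable P (bmeas_section2 y bf)).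
Qed.

Lemma bmeas_expect f : bmeas f -> bmeas (fun x => \E Q (fun y => f (x, y))).
Proof.
move=> bf; split; last first.
  have [_ [M fM]] := bf; exists M => x; apply: norm_expect_le => //.
  exact: bmeas_measurable (bmeas_section1 x bf).
apply: (measurableT_comp (f := fine)); first exact: fine_measurable.
exact: (measurable_fubini_F (m1 := dirac (point : T)) (m2 := Q)
  (bmeas_integrable _ bf)).
Qed.

End iterated_expectation.

Lemma measurable_preimage d d' (T : measurableType d) (T' : measurableType d')
    (phi : T -> T') A :
  measurable_fun [set: T] phi -> measurable A -> measurable (phi @^-1` A).
Proof. by move=> mphi mA; rewrite -[_ @^-1` _]setTI; exact: mphi. Qed.

Section transport.
Context {R : realType}.

Definition transports d d' (T : measurableType d) (T' : measurableType d')
    (mu : set T -> \bar R) (phi : T -> T') (nu : set T' -> \bar R) : Prop :=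
  measurable_fun [set: T] phi /\
  forall A, measurable A -> mu (phi @^-1` A) = nu A.

Lemma transports_comp d1 d2 d3 (T1 : measurableType d1) (T2 : measurableType d2)
    (T3 : measurableType d3) (mu1 : set T1 -> \bar R) (mu2 : set T2 -> \bar R)
    (mu3 : set T3 -> \bar R) (phi : T1 -> T2) (psi : T2 -> T3) :
  transports mu1 phi mu2 -> transports mu2 psi mu3 ->
  transports mu1 (psi \o phi) mu3.
Proof.
move=> [mphi phiE] [mpsi psiE]; split; first exact: measurableT_comp.
move=> A mA; rewrite -psiE// comp_preimage phiE//; exact: measurable_preimage.
Qed.

Lemma transports_conj d1 d2 (T1 : measurableType d1) (T2 : measurableType d2)
    (mu : set T1 -> \bar R) (nu : set T2 -> \bar R)
    (sigma : T1 -> T1) (phi : T1 -> T2) (tau : T2 -> T2) :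
  transports mu sigma mu -> transports mu phi nu ->
  measurable_fun [set: T2] tau -> tau \o phi =1 phi \o sigma ->
  transports nu tau nu.
Proof.
move=> musigma muphi mtau /funext conj; split=> // A mA.
have [_ phiE] := muphi; have [_ sigmaphiE] := transports_comp musigma muphi.
rewrite -[RHS]sigmaphiE// -conj comp_preimage phiE//.
exact: measurable_preimage.
Qed.

Section integral.
Context d d' (T : measurableType d) (T' : measurableType d').
Variables (mu : {measure set T -> \bar R}) (nu : {measure set T' -> \bar R}).
Variable phi : T -> T'.
Hypothesis phiE : transports mu phi nu.

Lemma ge0_integral_transports (f : T' -> \bar R) :
  measurable_fun [set: T'] f -> (forall y, 0 <= f y)%E ->
  (\int[mu]_x f (phi x) = \int[nu]_y f y)%E.
Proof.
case: phiE => mphi muE mf f0.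
rewrite [RHS](eq_measure_integral (pushforward mu phi))//.
  by rewrite [RHS]ge0_integral_pushforward.
by move=> A mA _; rewrite -muE.
Qed.

Lemma integrable_transports (f : T' -> R) :
  nu.-integrable [set: T'] (EFin \o f) ->
  mu.-integrable [set: T] (EFin \o (f \o phi)).
Proof.
move=> /integrableP[mf fi]; apply/integrableP; split.
  exact: (measurableT_comp mf phiE.1).
rewrite (ge0_integral_transports (f := fun y => `|(f y)%:E|%E))//.
exact: (measurableT_comp _ mf).
Qed.

Lemma expect_transports (f : T' -> R) :
  nu.-integrable [set: T'] (EFin \o f) ->
  \E mu (fun x => f (phi x)) = \E nu f.
Proof.
move=> fi; have [mphi muE] := phiE; rewrite /Rintegral; congr fine.
rewrite [RHS](eq_measure_integral (pushforward mu phi))//; last first.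
  by move=> A mA _; rewrite -muE.
rewrite [RHS]integral_pushforward ?preimage_setT//;
  first exact: measurable_int fi.
exact: integrable_transports.
Qed.

End integral.

Section probabilities.
Context d d' (T : measurableType d) (T' : measurableType d').
Variables (P : probability T R) (Q : probability T' R).

Lemma bexpect_transports (phi : T -> T') (f : T' -> R) :
  transports P phi Q -> bmeas f -> \E P (fun x => f (phi x)) = \E Q f.
Proof.
by move=> PQ bf; apply: expect_transports => //; exact: bmeas_integrable.
Qed.

Lemma transports_expect (phi : T -> T') : measurable_fun [set: T] phi ->
  (forall f : T' -> R, bmeas f -> \E P (fun x => f (phi x)) = \E Q f) ->
  transports P phi Q.
Proof.
move=> mphi PQ; split=> // A mA.
have mphiA := measurable_preimage mphi mA.
have bA : bmeas (\1_A : T' -> R).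
  split; first exact: measurable_indic.
  by exists 1 => x; rewrite indicE; case: (_ \in _); rewrite ?normr1 ?normr0.
have : \E P \1_(phi @^-1` A) = \E Q \1_A := PQ _ bA.
rewrite /Rintegral !integral_indic// !setIT => PQA.
by rewrite -[LHS]fineK ?PQA ?fineK ?fin_num_measure.
Qed.

End probabilities.

Section product.
Context d d' (T : measurableType d) (T' : measurableType d').
Variables (P : probability T R) (Q : probability T' R).

Lemma transports_fst : transports (P \x Q)%E fst P.
Proof.
apply: transports_expect => // f bf.
rewrite expect_prod;
  first by apply: eq_expect => x; rewrite -[RHS](expect_cst Q).
exact: (bmeas_comp bf).
Qed.

Lemma transports_snd : transports (P \x Q)%E snd Q.
Proof.
apply: transports_expect => // f bf.
rewrite expect_prod; first by rewrite -[RHS](expect_cst P).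
exact: (bmeas_comp bf).
Qed.

Lemma bexpect_fst (f : T -> R) : bmeas f ->
  \E (P \x Q)%E (fun p => f p.1) = \E P f.
Proof. exact: bexpect_transports transports_fst. Qed.

End product.

Lemma expect_anti_invariant d (T : measurableType d) (P : probability T R)
    (phi : T -> T) (f : T -> R) :
  transports P phi P -> P.-integrable [set: T] (EFin \o f) ->
  (forall x, f (phi x) = - f x) -> \E P f = 0.
Proof.
move=> Pphi fi fN; have : \E P f = -1 * \E P f; last by lra.
rewrite -[LHS](expect_transports Pphi fi) -RintegralZl//.
by apply: eq_expect => x; rewrite fN mulN1r.
Qed.

Lemma transports_pair d1 d2 d1' d2' (T1 : measurableType d1)
    (T2 : measurableType d2) (T1' : measurableType d1')
    (T2' : measurableType d2')
    (P1 : probability T1 R) (P2 : probability T2 R) (Q1 : probability T1' R)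
    (Q2 : probability T2' R) (phi1 : T1 -> T1') (phi2 : T2 -> T2') :
  transports P1 phi1 Q1 -> transports P2 phi2 Q2 ->
  transports (P1 \x P2)%E (fun p => (phi1 p.1, phi2 p.2)) (Q1 \x Q2)%E.
Proof.
move=> P1Q1 P2Q2; have [[m1 _] [m2 _]] := (P1Q1, P2Q2).
have mphi : measurable_fun [set: T1 * T2] (fun p => (phi1 p.1, phi2 p.2)).
  by apply: measurable_fun_pair; exact: measurableT_comp.
apply: transports_expect => // f bf.
rewrite expect_prod; last exact: bmeas_comp bf mphi.
rewrite expect_prod// -(bexpect_transports P1Q1 (bmeas_expect Q2 bf)).
apply: eq_expect => x;
  exact: (bexpect_transports P2Q2 (bmeas_section1 (phi1 x) bf)).
Qed.

Lemma transports_shuffle d1 d2 d3 d4 (T1 : measurableType d1)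
    (T2 : measurableType d2) (T3 : measurableType d3) (T4 : measurableType d4)
    (P1 : probability T1 R) (P2 : probability T2 R) (P3 : probability T3 R)
    (P4 : probability T4 R) :
  transports ((P1 \x P2) \x (P3 \x P4))%E
    (fun p => ((p.1.1, p.2.1), (p.1.2, p.2.2))) ((P1 \x P3) \x (P2 \x P4))%E.
Proof.
have mshuffle : measurable_fun [set: (T1 * T2) * (T3 * T4)]
    (fun p => ((p.1.1, p.2.1), (p.1.2, p.2.2))).
  by do 2 apply: measurable_fun_pair; exact: measurableT_comp.
apply: transports_expect => // f bf.
have bsh := bmeas_comp bf mshuffle.
rewrite expect_prod// [RHS]expect_prod//.
rewrite [RHS]expect_prod; last exact: (bmeas_expect _ bf).
rewrite expect_prod; last exact: (bmeas_expect _ bsh).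
apply: eq_expect => x.
transitivity (\E P2 (fun y => \E P3 (fun z => \E P4 (fun w =>
    f ((x, z), (y, w)))))).
  by apply: eq_expect => y; rewrite expect_prod//;
    exact: (bmeas_section1 _ bsh).
have bx : bmeas (fun q : (T2 * T3) * T4 => f ((x, q.1.2), (q.1.1, q.2))).
  apply: (bmeas_comp bf); do 2 apply: measurable_fun_pair => //;
  exact: measurableT_comp.
rewrite -(expect_prod _ _ (bmeas_expect P4 bx))
  (expect_prod21 _ _ (bmeas_expect P4 bx)).
apply: eq_expect => z; rewrite [RHS]expect_prod//; exact: (bmeas_section1 _ bf).
Qed.

End transport.

Section tuple_probability.
Context {R : realType} d (T : measurableType d) (P : probability T R).

Definition cons_pair n (p : T * n.-tuple T) : n.+1.-tuple T :=
  cons_tuple p.1 p.2.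

Lemma measurable_cons_pair n :
  measurable_fun [set: T * n.-tuple T] (@cons_pair n).
Proof. by apply: measurable_cons. Qed.

HB.instance Definition _ n := isMeasurableFun.Build _ _ _ _ (@cons_pair n)
  (@measurable_cons_pair n).

Fixpoint tuple_prob n : probability (n.-tuple T) R :=
  match n with
  | 0 => dirac ([tuple] : 0.-tuple T)
  | n'.+1 => distribution (P \x tuple_prob n')%E (@cons_pair n')
  end.

Lemma transports_cons_pair n :
  transports (P \x tuple_prob n)%E (@cons_pair n) (tuple_prob n.+1).
Proof. by split; first exact: measurable_cons_pair. Qed.

Lemma expect_tuple_prob0 (f : 0.-tuple T -> R) : bmeas f ->
  \E (tuple_prob 0) f = f [tuple].
Proof.
move=> [mf _]; rewrite /Rintegral /= integral_dirac ?diracT ?mul1e//.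
exact/measurable_EFinP.
Qed.

Lemma bmeas_cons_pair n (f : n.+1.-tuple T -> R) : bmeas f ->
  bmeas (fun p : T * n.-tuple T => f (cons_tuple p.1 p.2)).
Proof. by move=> bf; apply: (bmeas_comp bf); exact: measurable_cons_pair. Qed.

Lemma expect_tuple_probS n (f : n.+1.-tuple T -> R) : bmeas f ->
  \E (tuple_prob n.+1) f =
  \E P (fun t => \E (tuple_prob n) (fun x => f (cons_tuple t x))).
Proof.
move=> bf; rewrite -(bexpect_transports (transports_cons_pair n) bf).
exact/expect_prod/bmeas_cons_pair.
Qed.

Lemma transports_tnth n (i : 'I_n) :
  transports (tuple_prob n) (fun x => tnth x i) P.
Proof.
apply: transports_expect => [|f bf]; first exact: measurable_tnth.
elim: n i => [[]//|n IH] i.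
rewrite expect_tuple_probS; last exact: (bmeas_comp bf (measurable_tnth i)).
case: (unliftP ord0 i) => [j|] ->.
  rewrite -[RHS](expect_cst P); apply: eq_expect => t.
  by under eq_expect do rewrite tnthS.
by apply: eq_expect => t; under eq_expect do rewrite tnth0; rewrite expect_cst.
Qed.

Section sums_of_coordinates.
Variables (n : nat) (a : T -> R).
Hypothesis ba : bmeas a.

Lemma bmeas_tnth (i : 'I_n) : bmeas (fun x : n.-tuple T => a (tnth x i)).
Proof. exact: (bmeas_comp ba (measurable_tnth i)). Qed.

Lemma bmeas_sum_tnth : bmeas (fun x : n.-tuple T => \sum_(i < n) a (tnth x i)).
Proof. exact/bmeas_sum/bmeas_tnth. Qed.

Lemma expect_sum_tnth :
  \E (tuple_prob n) (fun x => \sum_(i < n) a (tnth x i)) = n%:R * \E P a.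
Proof.
rewrite expect_sum; last exact: bmeas_tnth.
under eq_bigr => i _ do rewrite (bexpect_transports (transports_tnth i) ba).
by rewrite sumr_const card_ord mulr_natl.
Qed.

End sums_of_coordinates.

Lemma expect_sqr_sum_tnth n (a : T -> R) : bmeas a -> \E P a = 0 ->
  \E (tuple_prob n) (fun x => (\sum_(i < n) a (tnth x i)) ^+ 2) =
  n%:R * \E P (fun t => a t ^+ 2).
Proof.
move=> ba a0; elim: n => [|n IH].
  under eq_expect do rewrite big_ord0 expr0n.
  by rewrite expect_cst mul0r.
have bS := bmeas_sum_tnth n ba; have bSS := bmeasX 2 bS.
rewrite expect_tuple_probS; last exact/bmeasX/bmeas_sum_tnth.
transitivity (\E P (fun t => a t ^+ 2 + n%:R * \E P (fun u => a u ^+ 2))).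
  apply: eq_expect => t.
  transitivity (\E (tuple_prob n) (fun x => a t ^+ 2 +
      (2 * a t * (\sum_(i < n) a (tnth x i)) +
       (\sum_(i < n) a (tnth x i)) ^+ 2))).
    apply: eq_expect => x; rewrite big_ord_recl tnth0.
    by under eq_bigr do rewrite tnthS; ring.
  rewrite expectD; [|exact: bmeas_cst|exact: (bmeasD (bmeasZ _ bS) bSS)].
  rewrite (expectD _ (bmeasZ _ bS) bSS) (expectZ _ _ bS).
  by rewrite expect_cst expect_sum_tnth// a0 !mulr0 add0r IH.
rewrite expectD; [|exact: bmeasX|exact: bmeas_cst].
by rewrite expect_cst -natr1; ring.
Qed.

End tuple_probability.

Section gauss.
Context {R : realType}.

Definition gauss1 : probability (measurableTypeR R) R := normal_prob 0 1.

Definition gauss n : probability (n.-tuple (measurableTypeR R)) R :=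
  tuple_prob gauss1 n.

Lemma gauss_expE n (g : n.-tuple R -> R) : bmeas g ->
  gauss_exp g = \E (gauss n) g.
Proof.
elim: n g => [g bg|n IH g bg]; first by rewrite expect_tuple_prob0.
rewrite expect_tuple_probS//=; apply: eq_Rintegral => t _.
by rewrite IH//; exact: (bmeas_section1 t (bmeas_cons_pair bg)).
Qed.

Lemma eq_gauss_exp n (f g : n.-tuple R -> R) : f =1 g ->
  gauss_exp f = gauss_exp g.
Proof. by move=> /funext ->. Qed.

Local Open Scope ereal_scope.

Lemma ge0_integral_normal_prob (m s : R) (f : R -> \bar R) :
  measurable_fun [set: R] f -> (forall x, 0 <= f x) ->
  \int[normal_prob m s]_x f x =
  \int[@lebesgue_measure R]_x (f x * (normal_pdf m s x)%:E).
Proof.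
move=> mf f0; pose nu : probability _ R := normal_prob m s.
have dom : nu `<< @lebesgue_measure R := normal_prob_dominates m s.
have mp : measurable_fun [set: measurableTypeR R]
    (fun x : measurableTypeR R => (normal_pdf m s x)%:E).
  by apply/measurable_EFinP; exact: measurable_normal_pdf.
rewrite -(Radon_Nikodym_SigmaFinite.change_of_variables (nu := nu) dom)//.
apply: ge0_ae_eq_integral => //.
- apply: emeasurable_funM => //.
  exact: measurable_int (Radon_Nikodym_SigmaFinite.f_integrable _).
- exact: emeasurable_funM.
- by move=> x _; rewrite mule_ge0// Radon_Nikodym_SigmaFinite.f_ge0.
- by move=> x _; rewrite mule_ge0// lee_fin normal_pdf_ge0.
- apply: ae_eqe_mul2l; apply: integral_ae_eq => //.
  + exact: Radon_Nikodym_SigmaFinite.f_integrable.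
  + by move=> E _ mE; rewrite -Radon_Nikodym_SigmaFinite.f_integral.
Qed.

End gauss.

Section transport_of_product_measures.
Context {R : realType} d1 d2 (T1 : measurableType d1) (T2 : measurableType d2).
Local Open Scope ereal_scope.

Lemma transports_skew d3 (T3 : measurableType d3)
    (mu1 : {measure set T1 -> \bar R})
    (mu2 : {sigma_finite_measure set T2 -> \bar R})
    (nu2 : {sigma_finite_measure set T3 -> \bar R}) (phi : T1 * T2 -> T3) :
  measurable_fun [set: T1 * T2] phi ->
  (forall x, transports mu2 (fun y => phi (x, y)) nu2) ->
  transports (mu1 \x mu2) (fun p => (p.1, phi p)) (mu1 \x nu2).
Proof.
move=> mphi phiE; split; first exact: measurable_fun_pair.
move=> A mA; apply: eq_integral => x _ /=.
rewrite -(phiE x).2; last exact: measurable_xsection.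
by congr (mu2 _); apply/seteqP; split=> y; rewrite /xsection /= !inE.
Qed.

Lemma transports_swap (mu1 : {sigma_finite_measure set T1 -> \bar R})
    (mu2 : {sigma_finite_measure set T2 -> \bar R}) :
  transports (mu1 \x mu2) (fun p => (p.2, p.1)) (mu2 \x mu1).
Proof.
have mswap : measurable_fun [set: T1 * T2] (fun p => (p.2, p.1)).
  exact: measurable_fun_pair.
split=> // A mA; symmetry.
apply: (product_measure_unique _ _ (m' := pushforward (mu1 \x mu2) _)) => //
  B C mB mC.
rewrite /= /pushforward muleC -product_measure1E//.
by congr ((_ \x _) _); apply/seteqP; split=> [[x y] []|[x y] []].
Qed.

End transport_of_product_measures.

Lemma transports_density {R : realType} d (T : measurableType d)
    (mu nu : {measure set T -> \bar R}) (f : T -> \bar R) (phi : T -> T) :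
  measurable_fun [set: T] f -> (forall x, 0 <= f x)%E ->
  (forall A, measurable A -> nu A = \int[mu]_(x in A) f x)%E ->
  transports mu phi mu -> (forall x, f (phi x) = f x) -> transports nu phi nu.
Proof.
move=> mf f0 nuE [mphi muphi] fphi; split=> // A mA.
rewrite !nuE//; last exact: measurable_preimage.
rewrite [RHS](eq_measure_integral (pushforward mu phi))//; last first.
  by move=> B mB _; rewrite -muphi.
rewrite [RHS]ge0_integral_pushforward//; last exact: measurable_funTS.
by apply: eq_integral => x _ /=; rewrite fphi.
Qed.

Section plane_rotations.
Context {R : realType}.
Local Notation mR := (measurableTypeR R).
Local Notation leb := (@lebesgue_measure R).
Local Notation leb2 := (leb \x leb)%E.
Local Notation gauss2 := (@gauss1 R \x @gauss1 R)%E.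

Definition xshear (k : R) (p : mR * mR) : mR * mR := (p.1 + k * p.2, p.2).

Definition yshear (k : R) (p : mR * mR) : mR * mR := (p.1, p.2 + k * p.1).

Definition rotation (c s : R) (p : mR * mR) : mR * mR :=
  (c * p.1 - s * p.2, s * p.1 + c * p.2).

Lemma transports_shift (k : R) : transports leb (fun x : mR => x + k : mR) leb.
Proof.
have mk : measurable_fun [set: mR] (fun x : mR => x + k : mR).
  exact: measurable_funD.
split=> // A mA; symmetry.
apply: (lebesgue_measure_unique (mu := pushforward leb _)) => //
  X [[a b] /= _ <-].
rewrite /pushforward (_ : _ @^-1` _ = `]a - k, b - k]%classic); last first.
  by apply/seteqP; split => x /=; rewrite !in_itv /= ltrBlDr lerBrDr.
rewrite !lebesgue_measure_itv /= !lte_fin ltrD2r.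
by case: ifP => // _; rewrite -!EFinB opprB addrA subrK.
Qed.

Lemma transports_yshear k : transports leb2 (yshear k) leb2.
Proof.
apply: (@transports_skew R _ _ mR mR _ mR leb leb leb (fun p => p.2 + k * p.1)).
  by apply: measurable_funD => //; exact: measurable_funM.
by move=> x; exact: (transports_shift (k * x)).
Qed.

Lemma transports_xshear k : transports leb2 (xshear k) leb2.
Proof.
pose swap (p : mR * mR) := (p.2, p.1).
have -> : xshear k = swap \o (yshear k \o swap) by apply/funext => -[].
apply: transports_comp; last exact: transports_swap.
by apply: transports_comp (transports_yshear k); exact: transports_swap.
Qed.

Lemma rotation_shears c s p : c ^+ 2 + s ^+ 2 = 1 -> s != 0 ->
  rotation c s p =
  xshear ((c - 1) / s) (yshear s (xshear ((c - 1) / s) p)).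
Proof.
move=> cs s0; have s2 : s ^+ 2 = 1 - c ^+ 2 by rewrite -cs; ring.
congr (_, _) => /=; last by field.
by transitivity (c * p.1 - s ^+ 2 / s * p.2); [field|rewrite s2; field].
Qed.

Lemma transports_rotation_lebesgue c s : c ^+ 2 + s ^+ 2 = 1 ->
  transports leb2 (rotation c s) leb2.
Proof.
have shears c0 s0 : c0 ^+ 2 + s0 ^+ 2 = 1 -> s0 != 0 ->
    transports leb2 (rotation c0 s0) leb2.
  move=> cs s0n0; set k := (c0 - 1) / s0.
  have -> : rotation c0 s0 = xshear k \o (yshear s0 \o xshear k).
    by apply/funext => p; exact: rotation_shears.
  apply: transports_comp (transports_xshear k).
  exact: transports_comp (transports_xshear k) (transports_yshear s0).
have [->|s0] := eqVneq s 0; last by move=> cs; exact: shears.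
rewrite expr0n addr0 => /eqP; rewrite sqrf_eq1 => /predU1P[->|/eqP ->].
  rewrite (_ : rotation 1 0 = id); last first.
    by apply/funext => -[x y]; congr (_, _) => /=; ring.
  by split.
(* Rotation by pi is the square of the rotation by pi/2, for which s <> 0. *)
rewrite (_ : rotation (-1) 0 = rotation 0 1 \o rotation 0 1); last first.
  by apply/funext => -[x y]; congr (_, _) => /=; ring.
have quarter : transports leb2 (rotation 0 1) leb2.
  by apply: shears; [ring|exact: oner_neq0].
exact: (transports_comp quarter quarter).
Qed.

Local Open Scope ereal_scope.

Definition gauss2_pdf (p : mR * mR) : \bar R :=
  (normal_pdf 0 1 p.1)%:E * (normal_pdf 0 1 p.2)%:E.

Lemma gauss2_pdf_ge0 p : 0 <= gauss2_pdf p.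
Proof. by rewrite mule_ge0// lee_fin normal_pdf_ge0. Qed.

Lemma measurable_gauss2_pdf : measurable_fun [set: mR * mR] gauss2_pdf.
Proof.
by apply: emeasurable_funM; apply/measurable_EFinP;
  exact: (measurableT_comp (measurable_normal_pdf _ _)).
Qed.

Lemma gauss2_density A : measurable A ->
  gauss2 A = \int[leb2]_(p in A) gauss2_pdf p.
Proof.
move=> mA; have mg := measurable_gauss2_pdf.
rewrite integral_mkcond fubini_tonelli1//; first last.
- by apply: erestrict_ge0 => p _; exact: gauss2_pdf_ge0.
- exact/(measurable_restrictT _ mA)/measurable_funTS.
rewrite /product_measure1 ge0_integral_normal_prob//;
  last exact: measurable_fun_xsection.
apply: eq_integral => x _ /=; rewrite /fubini_F.
rewrite (_ : (fun y => _) = (fun y => gauss2_pdf (x, y)) \_ (xsection A x));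
  last first.
  by apply/funext => y; rewrite !patchE mem_xsection.
rewrite -integral_mkcond muleC -ge0_integralZl//.
- exact: measurable_xsection.
- by apply/measurable_funTS/measurable_EFinP; exact: measurable_normal_pdf.
- by move=> y _; rewrite lee_fin normal_pdf_ge0.
- by rewrite lee_fin normal_pdf_ge0.
Qed.

Lemma transports_rotation_gauss2 c s : (c ^+ 2 + s ^+ 2 = 1)%R ->
  transports gauss2 (rotation c s) gauss2.
Proof.
move=> cs; apply: (transports_density measurable_gauss2_pdf gauss2_pdf_ge0
  gauss2_density (transports_rotation_lebesgue cs)) => p.
rewrite /gauss2_pdf -!EFinM; congr EFin; rewrite !normal_pdfE ?oner_eq0//.
rewrite /normal_fun mulrACA [RHS]mulrACA; congr (_ * _)%R.
rewrite -!expRD; congr expR; rewrite !subr0 !mulNr -!opprD -!mulrDl.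
by congr (- (_ / _))%R; rewrite -[RHS]mul1r -cs /=; ring.
Qed.

End plane_rotations.

Section gaussian_rotations.
Context {R : realType}.
Local Notation mR := (measurableTypeR R).
Local Notation V n := (n.-tuple mR).
Local Notation gauss2 n := (gauss n \x gauss n)%E.

Lemma lincomb_cons n (a b t u : R) (x y : n.-tuple R) :
  lincomb a (cons_tuple t x) b (cons_tuple u y) =
  cons_tuple (a * t + b * u) (lincomb a x b y).
Proof.
apply: eq_from_tnth => i; rewrite tnth_mktuple.
case: (unliftP ord0 i) => [j ->|->]; last by rewrite !tnth0.
by rewrite !tnthS tnth_mktuple.
Qed.

Lemma measurable_lincomb d (T : measurableType d) n (a b : R) (f g : T -> V n) :
  measurable_fun [set: T] f -> measurable_fun [set: T] g ->
  measurable_fun [set: T] (fun x => lincomb a (f x) b (g x) : V n).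
Proof.
move=> mf mg; apply/measurable_fun_tnthP => i.
rewrite (_ : _ \o _ = fun x => a * tnth (f x) i + b * tnth (g x) i); last first.
  by apply/funext => x /=; rewrite tnth_mktuple.
have mtnth h : measurable_fun [set: T] h ->
    measurable_fun [set: T] (fun x => tnth (h x) i : mR).
  exact: (measurableT_comp (measurable_tnth i)).
by apply: measurable_funD; apply: measurable_funM => //; exact: mtnth.
Qed.

Definition vrotation n (c s : R) (p : V n * V n) : V n * V n :=
  (lincomb c p.1 (- s) p.2, lincomb s p.1 c p.2).

Lemma measurable_vrotation n c s :
  measurable_fun [set: V n * V n] (vrotation c s).
Proof. by apply: measurable_fun_pair; exact: measurable_lincomb. Qed.

Lemma transports_vrotation n c s : c ^+ 2 + s ^+ 2 = 1 ->
  transports (gauss2 n) (vrotation c s) (gauss2 n).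
Proof.
move=> cs; elim: n => [|n IH].
  rewrite (_ : vrotation c s = id); first by split.
  by apply/funext => -[x y]; congr (_, _); apply: eq_from_tnth => -[].
have transports_cons := transports_cons_pair (@gauss1 R) n.
have transports_zip := transports_comp
  (transports_shuffle gauss1 gauss1 (gauss n) (gauss n))
  (transports_pair transports_cons transports_cons).
apply: (transports_conj (transports_pair (transports_rotation_gauss2 cs) IH)
  transports_zip).
- exact: measurable_vrotation.
- by move=> p; rewrite /vrotation /cons_pair /= !lincomb_cons !mulNr.
Qed.

Lemma expect_vrotation n c s (f : V n * V n -> R) : c ^+ 2 + s ^+ 2 = 1 ->
  bmeas f -> \E (gauss2 n) (fun p => f (vrotation c s p)) = \E (gauss2 n) f.
Proof.
by move=> cs; apply: bexpect_transports; exact: transports_vrotation.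
Qed.

End gaussian_rotations.

Section inner_product.
Context {R : realType}.

Lemma dotvC n (u v : n.-tuple R) : dotv u v = dotv v u.
Proof. by apply: eq_bigr => i _; rewrite mulrC. Qed.

Lemma dotv_cons n (a b : R) (u v : n.-tuple R) :
  dotv (cons_tuple a u) (cons_tuple b v) = a * b + dotv u v.
Proof.
rewrite /dotv big_ord_recl !tnth0; congr (_ + _).
by apply: eq_bigr => j _; rewrite !tnthS.
Qed.

Lemma dotv_ge0 n (u : n.-tuple R) : 0 <= dotv u u.
Proof. by apply: sumr_ge0 => i _; rewrite -expr2 sqr_ge0. Qed.

Lemma normv_ge0 n (u : n.-tuple R) : 0 <= normv u.
Proof. exact: sqrtr_ge0. Qed.

Lemma normv_sqr n (u : n.-tuple R) : normv u ^+ 2 = dotv u u.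
Proof. by rewrite sqr_sqrtr// dotv_ge0. Qed.

Lemma normv_eq1 n (u : n.-tuple R) : (normv u = 1) <-> (dotv u u = 1).
Proof.
by split=> [u1|];
  [rewrite -normv_sqr u1 expr1n|rewrite /normv => ->; exact: sqrtr1].
Qed.

Lemma normv_le1 n (u : n.-tuple R) : (normv u <= 1) = (dotv u u <= 1).
Proof. by rewrite -normv_sqr expr_le1// normv_ge0. Qed.

Lemma normv_eq0 n (u : n.-tuple R) : (normv u == 0) = (dotv u u == 0).
Proof. by rewrite -normv_sqr sqrf_eq0. Qed.

Lemma dotv0l n (v : n.-tuple R) : dotv [tuple 0 | i < n] v = 0.
Proof. by rewrite /dotv big1// => i _; rewrite tnth_mktuple mul0r. Qed.

Lemma dotvZl n a (u v : n.-tuple R) :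
  dotv [tuple a * tnth u i | i < n] v = a * dotv u v.
Proof.
by rewrite mulr_sumr; apply: eq_bigr => i _; rewrite tnth_mktuple mulrA.
Qed.

Lemma dotvZr n a (u v : n.-tuple R) :
  dotv u [tuple a * tnth v i | i < n] = a * dotv u v.
Proof. by rewrite dotvC dotvZl dotvC. Qed.

Lemma sqr_tnth_le n (u : n.-tuple R) i : tnth u i ^+ 2 <= dotv u u.
Proof.
rewrite /dotv (bigD1 i)//= -expr2 lerDl; apply: sumr_ge0 => j _.
by rewrite -expr2 sqr_ge0.
Qed.

Lemma dotv_eq0_tnth n (u : n.-tuple R) i : dotv u u = 0 -> tnth u i = 0.
Proof.
move=> u0; apply/eqP; rewrite -sqrf_eq0 eq_le sqr_ge0 andbT -u0.
exact: sqr_tnth_le.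
Qed.

Lemma dotv_ball_bound n (u v : n.-tuple R) :
  dotv u u <= 1 -> dotv v v <= 1 -> -1 <= dotv u v <= 1.
Proof.
move=> u1 v1.
have norm_lincomb (e : R) :
    0 <= dotv u u + e ^+ 2 * dotv v v + e * 2 * dotv u v.
  rewrite !mulr_sumr -!big_split; apply: sumr_ge0 => i _ /=.
  have -> : tnth u i * tnth u i + e ^+ 2 * (tnth v i * tnth v i) +
    e * 2 * (tnth u i * tnth v i) = (tnth u i + e * tnth v i) ^+ 2 by ring.
  exact: sqr_ge0.
by have := norm_lincomb 1; have := norm_lincomb (-1);
  rewrite sqrrN !expr1n; lra.
Qed.

Lemma lincomb10 n (x y : n.-tuple R) : lincomb 1 x 0 y = x.
Proof.
by apply: eq_from_tnth => i; rewrite tnth_mktuple mul1r mul0r addr0.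
Qed.

End inner_product.

Section cholesky.
Context {R : realType}.

Definition is_cholesky (a b c g11 g12 g22 : R) : Prop :=
  [/\ 0 <= a, 0 <= c, a ^+ 2 = g11, a * b = g12 & b ^+ 2 + c ^+ 2 = g22].

Lemma is_cholesky_unit a b c rho : is_cholesky a b c 1 rho 1 ->
  [/\ a = 1, b = rho & c = Num.sqrt (1 - rho ^+ 2)].
Proof.
move=> [a0 c0 a2 ab bc2].
have a1 : a = 1 by apply/eqP; rewrite -(eqrXn2 (n := 2))// a2 expr1n.
have b_rho : b = rho by rewrite -ab a1 mul1r.
by split=> //; rewrite -bc2 -b_rho addrC addKr sqrtr_sqr ger0_norm.
Qed.

Lemma polar_coordinates (p q : R) : exists r c s,
  [/\ 0 <= r, c ^+ 2 + s ^+ 2 = 1, p = r * c & q = r * s].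
Proof.
have pq_ge0 : 0 <= p ^+ 2 + q ^+ 2 by rewrite addr_ge0 ?sqr_ge0.
have [pq0|pq0] := eqVneq (p ^+ 2 + q ^+ 2) 0.
  have /andP[/eqP p0 /eqP q0] : (p == 0) && (q == 0).
    by move/eqP: pq0; rewrite paddr_eq0 ?sqr_ge0// !sqrf_eq0.
  by exists 0, 1, 0; rewrite p0 q0 !mul0r; split=> //; ring.
pose r := Num.sqrt (p ^+ 2 + q ^+ 2).
have r2 : r ^+ 2 = p ^+ 2 + q ^+ 2 by rewrite sqr_sqrtr.
have r0 : r != 0 by rewrite -sqrf_eq0 r2.
exists r, (p / r), (q / r); split; rewrite ?sqrtr_ge0//.
- by rewrite !expr_div_n -mulrDl -r2 divff// sqrf_eq0.
- by rewrite mulrC mulfVK.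
- by rewrite mulrC mulfVK.
Qed.

End cholesky.

Section gaussian_pairs.
Context {R : realType}.
Local Notation mR := (measurableTypeR R).
Local Notation V n := (n.-tuple mR).
Local Notation gauss2 k := (gauss k \x gauss k)%E.

Definition lower_tri k (a b c : R) (p : V k * V k) : V k * V k :=
  (lincomb a p.1 0 p.2, lincomb b p.1 c p.2).

Lemma measurable_lower_tri k a b c :
  measurable_fun [set: V k * V k] (lower_tri a b c).
Proof. by apply: measurable_fun_pair; exact: measurable_lincomb. Qed.

HB.instance Definition _ k a b c := isMeasurableFun.Build _ _ _ _
  (@lower_tri k a b c) (measurable_lower_tri a b c).

Definition tri_gauss k (a b c : R) : probability (V k * V k)%type R :=
  distribution (gauss2 k) (@lower_tri k a b c).

Definition corr_gauss k (rho : R) :=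
  tri_gauss k 1 rho (Num.sqrt (1 - rho ^+ 2)).

Lemma transports_lower_tri k a b c :
  transports (gauss2 k) (lower_tri a b c) (tri_gauss k a b c).
Proof. by split; first exact: measurable_lower_tri. Qed.

Lemma expect_tri_gauss k a b c (f : V k * V k -> R) : bmeas f ->
  \E (tri_gauss k a b c) f = \E (gauss k) (fun x => \E (gauss k) (fun y =>
    f (lincomb a x 0 y, lincomb b x c y))).
Proof.
move=> bf; rewrite -(bexpect_transports (transports_lower_tri k a b c) bf).
exact/expect_prod/(bmeas_comp bf (measurable_lower_tri a b c)).
Qed.

Lemma bmeas_lincomb_pair d (T : measurableType d) k (a b a' b' : R)
    (g h g' h' : T -> V k) (f : V k * V k -> R) :
  measurable_fun [set: T] g -> measurable_fun [set: T] h ->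
  measurable_fun [set: T] g' -> measurable_fun [set: T] h' -> bmeas f ->
  bmeas (fun t => f (lincomb a (g t) b (h t), lincomb a' (g' t) b' (h' t))).
Proof.
move=> mg mh mg' mh' bf; apply: (bmeas_comp bf).
by apply: measurable_fun_pair; exact: measurable_lincomb.
Qed.

Lemma expect_lincomb_rotation k (c s p a q b : R) (f : V k * V k -> R) :
  c ^+ 2 + s ^+ 2 = 1 -> bmeas f ->
  \E (gauss k) (fun x => \E (gauss k) (fun y =>
    f (lincomb p x a y, lincomb q x b y))) =
  \E (gauss k) (fun x => \E (gauss k) (fun y =>
    f (lincomb (p * c + a * s) x (a * c - p * s) y,
       lincomb (q * c + b * s) x (b * c - q * s) y))).
Proof.
move=> cs bf; pose h p' a' q' b' (z : V k * V k) :=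
  f (lincomb p' z.1 a' z.2, lincomb q' z.1 b' z.2).
have bh p' a' q' b' : bmeas (h p' a' q' b') by exact: bmeas_lincomb_pair.
rewrite -(expect_prod _ _ (bh p a q b)) -(expect_prod _ _ (bh _ _ _ _)).
rewrite -(expect_vrotation cs (bh p a q b)); apply: eq_expect => z.
by congr (f (_, _)); apply: eq_from_tnth => i; rewrite !tnth_mktuple; ring.
Qed.

(* The first rotation clears x from the first component, the second one clears y
   from the second component. *)
Lemma expect_lincomb_tri_gauss k (p q a b c c1 s1 c2 s2 : R)
    (d := b * c1 - q * s1) (f : V k * V k -> R) :
  c1 ^+ 2 + s1 ^+ 2 = 1 -> a * c1 - p * s1 = 0 ->
  c2 ^+ 2 + s2 ^+ 2 = 1 -> c * c2 - d * s2 = 0 -> bmeas f ->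
  \E (gauss k) (fun t => \E (tri_gauss k a b c) (fun z =>
    f (lincomb p t 1 z.1, lincomb q t 1 z.2))) =
  \E (tri_gauss k (p * c1 + a * s1) (q * c1 + b * s1) (d * c2 + c * s2)) f.
Proof.
move=> cs1 clear1 cs2 clear2 bf; rewrite expect_tri_gauss//.
pose F (z : V k * V k) := \E (gauss k) (fun y => f (z.1, lincomb 1 z.2 c y)).
have bF : bmeas F.
  pose f' (r : (V k * V k) * V k) := f (r.1.1, lincomb 1 r.1.2 c r.2).
  suff bf' : bmeas f' by exact: (bmeas_expect (gauss k) bf').
  apply: (bmeas_comp bf); apply: measurable_fun_pair.
    exact: measurableT_comp.
  by apply: measurable_lincomb => //; exact: measurableT_comp.
transitivity (\E (gauss k) (fun t => \E (gauss k) (fun x =>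
    F (lincomb p t a x, lincomb q t b x)))).
  apply: eq_expect => t; rewrite expect_tri_gauss; last first.
    exact: bmeas_lincomb_pair.
  apply: eq_expect => x; apply: eq_expect => y.
  by congr (f (_, _)); apply: eq_from_tnth => i; rewrite !tnth_mktuple; ring.
rewrite (expect_lincomb_rotation p a q b cs1 bF) clear1 -/d.
set a' := p * c1 + _; set b' := q * c1 + _; apply: eq_expect => t.
pose G (z : V k * V k) := f (lincomb a' t 0 t, lincomb b' t 1 z.1).
have bG : bmeas G by exact: bmeas_lincomb_pair.
transitivity (\E (gauss k) (fun x => \E (gauss k) (fun y =>
    G (lincomb d x c y, lincomb 0 x 0 y)))).
  apply: eq_expect => x; apply: eq_expect => y.
  by congr (f (_, _)); apply: eq_from_tnth => i; rewrite !tnth_mktuple; ring.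
rewrite (expect_lincomb_rotation d c 0 0 cs2 bG) clear2.
apply: eq_expect => x; rewrite -[RHS](expect_cst (gauss k)).
apply: eq_expect => y.
by congr (f (_, _)); apply: eq_from_tnth => i; rewrite !tnth_mktuple; ring.
Qed.

Lemma exists_tri_gauss_lincomb k (p q a b c : R) : exists a' b' c',
  is_cholesky a' b' c' (p ^+ 2 + a ^+ 2) (p * q + a * b)
    (q ^+ 2 + (b ^+ 2 + c ^+ 2)) /\
  forall f : V k * V k -> R, bmeas f ->
  \E (gauss k) (fun t => \E (tri_gauss k a b c) (fun z =>
    f (lincomb p t 1 z.1, lincomb q t 1 z.2))) = \E (tri_gauss k a' b' c') f.
Proof.
have [a' [c1 [s1 [a'0 cs1 pE aE]]]] := polar_coordinates p a.
pose b' := q * c1 + b * s1; pose d := b * c1 - q * s1.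
have [c' [c2 [s2 [c'0 cs2 dE cE]]]] := polar_coordinates d c.
have a'E : p * c1 + a * s1 = a' by rewrite pE aE -[RHS]mulr1 -cs1; ring.
have c'E : d * c2 + c * s2 = c' by rewrite dE cE -[RHS]mulr1 -cs2; ring.
exists a', b', c'; split=> [|f bf].
  split=> //.
  - by rewrite pE aE -[LHS]mulr1 -cs1; ring.
  - by rewrite pE aE /b'; ring.
  - have <- : d ^+ 2 + c ^+ 2 = c' ^+ 2.
      by rewrite dE cE -[RHS]mulr1 -cs2; ring.
    by rewrite -[q ^+ 2]mulr1 -[b ^+ 2]mulr1 -cs1 /b' /d; ring.
rewrite (expect_lincomb_tri_gauss cs1 _ cs2 _ bf) -/d ?a'E ?c'E//.
- by rewrite pE aE; ring.
- by rewrite dE cE; ring.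
Qed.

End gaussian_pairs.

Section gaussian_matrices.
Context {R : realType}.
Local Notation mR := (measurableTypeR R).
Local Notation V n := (n.-tuple mR).

Definition colcomb k m (u : m.-tuple R) (Z : m.-tuple (V k)) : V k :=
  [tuple \sum_(j < m) tnth u j * tnth (tnth Z j) i | i < k].

Lemma colcomb_cons k m a (u : m.-tuple R) t (Z : m.-tuple (V k)) :
  colcomb (cons_tuple a u) (cons_tuple t Z) = lincomb a t 1 (colcomb u Z).
Proof.
apply: eq_from_tnth => i; rewrite !tnth_mktuple big_ord_recl !tnth0 mul1r.
by congr (_ + _); apply: eq_bigr => j _; rewrite !tnthS.
Qed.

Lemma measurable_colcomb k m (u : m.-tuple R) :
  measurable_fun [set: m.-tuple (V k)] (colcomb u).
Proof.
apply/measurable_fun_tnthP => i.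
rewrite (_ : _ \o _ = fun Z => \sum_(j < m) tnth u j * tnth (tnth Z j) i);
  last first.
  by apply/funext => x /=; rewrite tnth_mktuple.
apply: measurable_sum => j; apply: measurable_funM => //.
exact: (measurableT_comp (measurable_tnth i) (measurable_tnth j)).
Qed.

Lemma measurable_colcomb2 k m (u v : m.-tuple R) :
  measurable_fun [set: m.-tuple (V k)] (fun Z => (colcomb u Z, colcomb v Z)).
Proof. by apply: measurable_fun_pair; exact: measurable_colcomb. Qed.

Lemma transports_colcomb_cholesky k m (u v : m.-tuple R) : exists a b c,
  is_cholesky a b c (dotv u u) (dotv u v) (dotv v v) /\
  transports (tuple_prob (gauss k) m) (fun Z => (colcomb u Z, colcomb v Z))
    (tri_gauss k a b c).
Proof.
elim: m u v => [|m IH] u v.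
  exists 0, 0, 0; rewrite /dotv !big_ord0; split; first by split=> //; ring.
  apply: transports_expect => [|f bf]; first exact: measurable_colcomb2.
  rewrite expect_tuple_prob0;
    last exact: (bmeas_comp bf (measurable_colcomb2 u v)).
  rewrite expect_tri_gauss// -[LHS](expect_cst (gauss k)).
  apply: eq_expect => x.
  rewrite -[LHS](expect_cst (gauss k)); apply: eq_expect => y.
  by congr (f (_, _)); apply: eq_from_tnth => i;
    rewrite !tnth_mktuple big_ord0 !mul0r addr0.
case/tupleP: u => p u; case/tupleP: v => q v.
have [a [b [c [[_ _ a2 ab bc2] uvZ]]]] := IH u v.
have [a' [b' [c' [chol' lincombE]]]] := exists_tri_gauss_lincomb k p q a b c.
exists a', b', c'; split.
  by rewrite !dotv_cons -!expr2 -a2 -ab -bc2.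
apply: transports_expect => [|f bf]; first exact: measurable_colcomb2.
rewrite expect_tuple_probS;
  last exact: (bmeas_comp bf (measurable_colcomb2 _ _)).
rewrite -lincombE//; apply: eq_expect => t.
under eq_expect do rewrite !colcomb_cons.
have bg : bmeas (fun z : V k * V k => f (lincomb p t 1 z.1, lincomb q t 1 z.2)).
  exact: bmeas_lincomb_pair.
exact: (bexpect_transports uvZ bg).
Qed.

Lemma transports_colcomb k m (u v : m.-tuple R) :
  normv u = 1 -> normv v = 1 ->
  transports (tuple_prob (gauss k) m) (fun Z => (colcomb u Z, colcomb v Z))
    (corr_gauss k (dotv u v)).
Proof.
move=> /normv_eq1 u1 /normv_eq1 v1.
have [a [b [c []]]] := transports_colcomb_cholesky k u v.
by rewrite u1 v1 => /is_cholesky_unit[-> -> ->].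
Qed.

End gaussian_matrices.

Section correlated_gaussians.
Context {R : realType}.
Local Notation mR := (measurableTypeR R).
Local Notation V n := (n.-tuple mR).
Local Notation gauss2 n := (gauss n \x gauss n)%E.
Variables (k : nat) (rho : R).
Local Notation s := (Num.sqrt (1 - rho ^+ 2)).

Lemma expect_corr_gauss (f : V k * V k -> R) : bmeas f ->
  \E (corr_gauss k rho) f = \E (gauss k) (fun x => \E (gauss k) (fun y =>
    f (x, lincomb rho x s y))).
Proof.
move=> bf; rewrite (expect_tri_gauss _ _ _ bf).
by apply: eq_expect => x; apply: eq_expect => y; rewrite lincomb10.
Qed.

Lemma expect_corr_gauss_fst (h : V k -> R) : bmeas h ->
  \E (corr_gauss k rho) (fun p => h p.1) = \E (gauss k) h.
Proof.
move=> bh; rewrite expect_corr_gauss; last exact: (bmeas_comp bh).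
by apply: eq_expect => x; rewrite -[RHS](expect_cst (gauss k)).
Qed.

Lemma sqr_sqrt_onem_sqr : -1 <= rho <= 1 -> s ^+ 2 = 1 - rho ^+ 2.
Proof.
move=> rho1; rewrite sqr_sqrtr// subr_ge0 -real_normK ?num_real//.
by rewrite expr_le1// ler_norml.
Qed.

Lemma expect_corr_gauss_snd (h : V k -> R) : -1 <= rho <= 1 -> bmeas h ->
  \E (corr_gauss k rho) (fun p => h p.2) = \E (gauss k) h.
Proof.
move=> rho1 bh; have bh1 : bmeas (fun p : V k * V k => h p.1).
  by apply: (bmeas_comp bh).
have cs : rho ^+ 2 + (- s) ^+ 2 = 1 by rewrite sqrrN sqr_sqrt_onem_sqr// subrKC.
rewrite -(bexpect_fst _ (gauss k) bh) -(expect_vrotation cs bh1).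
rewrite expect_corr_gauss; last exact: (bmeas_comp bh).
rewrite expect_prod; last exact: (bmeas_comp bh1 (measurable_vrotation _ _)).
by apply: eq_expect => x; apply: eq_expect => y; rewrite /= opprK.
Qed.

Lemma expect_corr_gauss_tnth (i : 'I_k) (f : mR * mR -> R) : bmeas f ->
  \E (corr_gauss k rho) (fun p => f (tnth p.1 i, tnth p.2 i)) =
  \E (gauss1 \x gauss1)%E (fun p => f (p.1, rho * p.1 + s * p.2)).
Proof.
move=> bf; pose g (p : mR * mR) := f (p.1, rho * p.1 + s * p.2).
have bg : bmeas g.
  apply: (bmeas_comp bf); apply: measurable_fun_pair => //.
  by apply: measurable_funD; exact: measurable_funM.
rewrite -[RHS](bexpect_transports (transports_pair
  (transports_tnth gauss1 i) (transports_tnth gauss1 i)) bg).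
have mtnth2 : measurable_fun [set: V k * V k]
    (fun p => (tnth p.1 i, tnth p.2 i)).
  by apply: measurable_fun_pair; exact: (measurableT_comp (measurable_tnth i)).
rewrite expect_corr_gauss; last exact: (bmeas_comp bf mtnth2).
rewrite [RHS]expect_prod; last exact: (bmeas_comp bg mtnth2).
by apply: eq_expect => x; apply: eq_expect => y; rewrite /g /= tnth_mktuple.
Qed.

End correlated_gaussians.

Section normalization.
Context {R : realType}.
Local Notation mR := (measurableTypeR R).
Local Notation V n := (n.-tuple mR).

Lemma dotv_normalize n (x y : n.-tuple R) :
  dotv (normalize x) (normalize y) = dotv x y / (normv x * normv y).
Proof.
rewrite mulr_suml; apply: eq_bigr => i _; rewrite !tnth_mktuple.
by rewrite mulf_div.
Qed.

Lemma dotv_normalize_self n (x : n.-tuple R) :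
  dotv (normalize x) (normalize x) = (normv x != 0)%:R.
Proof.
rewrite dotv_normalize -expr2 -normv_sqr -expr_div_n.
by have [->|x0] := eqVneq (normv x) 0;
  rewrite ?invr0 ?mulr0 ?divff ?expr0n ?expr1n.
Qed.

Lemma dotv_normalize_le1 n (x : n.-tuple R) :
  dotv (normalize x) (normalize x) <= 1.
Proof. by rewrite dotv_normalize_self; case: (_ != _). Qed.

Lemma measurable_fun_dotv d (T : measurableType d) n (f g : T -> V n) :
  measurable_fun [set: T] f -> measurable_fun [set: T] g ->
  measurable_fun [set: T] (fun x => dotv (f x) (g x)).
Proof.
move=> mf mg; apply: measurable_sum => i; apply: measurable_funM.
- exact: (measurableT_comp (measurable_tnth i) mf).
- exact: (measurableT_comp (measurable_tnth i) mg).
Qed.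

Lemma bmeas_dotv d (T : measurableType d) n (f g : T -> V n) :
  measurable_fun [set: T] f -> measurable_fun [set: T] g ->
  (forall x, dotv (f x) (f x) <= 1) -> (forall x, dotv (g x) (g x) <= 1) ->
  bmeas (fun x => dotv (f x) (g x)).
Proof.
move=> mf mg f1 g1; split; first exact: measurable_fun_dotv.
by exists 1 => x; rewrite ler_norml; exact: dotv_ball_bound.
Qed.

Lemma measurable_invsqrt d (T : measurableType d) (f : T -> R) :
  measurable_fun [set: T] f -> (forall x, 0 <= f x) ->
  measurable_fun [set: T] (fun x => (Num.sqrt (f x))^-1).
Proof.
move=> mf f0; under eq_fun do rewrite -powR12_sqrt// -powRN.
exact: (measurableT_comp (measurable_powR _)).
Qed.

Lemma measurable_normalize n :
  measurable_fun [set: V n] (@normalize R n : V n -> V n).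
Proof.
apply/measurable_fun_tnthP => i.
rewrite (_ : _ \o _ = fun x => tnth x i * (normv x)^-1); last first.
  by apply/funext => x /=; rewrite tnth_mktuple.
apply: measurable_funM; first exact: measurable_tnth.
by apply: measurable_invsqrt; [exact: measurable_fun_dotv|exact: dotv_ge0].
Qed.

Definition cos_angle n (p : V n * V n) : R :=
  dotv (normalize p.1) (normalize p.2).

Lemma bmeas_cos_angle n : bmeas (@cos_angle n).
Proof.
by apply: bmeas_dotv => [||x|x]; do ?[exact: dotv_normalize_le1];
  apply: (measurableT_comp (@measurable_normalize n)).
Qed.

Lemma gauss_exp2E n (f : V n * V n -> R) : bmeas f ->
  gauss_exp (fun x => gauss_exp (fun y => f (x, y))) =
  \E (gauss n) (fun x => \E (gauss n) (fun y => f (x, y))).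
Proof.
move=> bf; rewrite -gauss_expE; last exact: bmeas_expect.
by apply: eq_gauss_exp => x; rewrite -gauss_expE//; exact: bmeas_section1.
Qed.

Lemma FstarE k (rho : R) : Fstar k rho = \E (corr_gauss k rho) (@cos_angle k).
Proof.
rewrite expect_tri_gauss; last exact: bmeas_cos_angle.
exact: gauss_exp2E
  (bmeas_comp (@bmeas_cos_angle k) (measurable_lower_tri _ _ _)).
Qed.

Lemma Fstar_le1 k (rho : R) : Fstar k rho <= 1.
Proof.
rewrite FstarE (le_trans (ler_norm _))//; apply: norm_expect_le.
  exact: bmeas_measurable (bmeas_cos_angle k).
by move=> p; rewrite ler_norml; apply: dotv_ball_bound;
  exact: dotv_normalize_le1.
Qed.

Lemma StabE n (rho : R) (f : V n -> V 3) : measurable_fun [set: V n] f ->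
  (forall x, dotv (f x) (f x) <= 1) ->
  Stab rho f = \E (corr_gauss n rho) (fun p => dotv (f p.1) (f p.2)).
Proof.
move=> mf f1; pose F (p : V n * V n) := dotv (f p.1) (f p.2).
have bF : bmeas F by apply: bmeas_dotv => //; exact: measurableT_comp.
rewrite expect_tri_gauss//.
rewrite -[RHS](gauss_exp2E (bmeas_comp bF (measurable_lower_tri _ _ _))).
apply: eq_gauss_exp => x; apply: eq_gauss_exp => y.
by rewrite /F /= lincomb10.
Qed.

Lemma gauss_exp_cst n (c : R) : @gauss_exp R n (fun=> c) = c.
Proof. by rewrite gauss_expE; [exact: expect_cst|exact: bmeas_cst]. Qed.

Lemma gauss_exp_first3 n (G : 3.-tuple R -> R) :
  @gauss_exp R n.+3 (fun x => G [tuple nth 0 x i | i < 3]) = gauss_exp G.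
Proof.
rewrite /=; apply: eq_Rintegral => t1 _; apply: eq_Rintegral => t2 _.
apply: eq_Rintegral => t3 _; rewrite -[RHS](gauss_exp_cst n).
apply: eq_gauss_exp => x; congr G; apply: eq_from_tnth => i.
by rewrite tnth_mktuple (tnth_nth 0); case: i => -[|[|[|]]].
Qed.

Lemma Stab_fopt3 n (rho : R) : (3 <= n)%N ->
  Stab rho (@fopt3 R n) = Fstar 3 rho.
Proof.
move=> n3; rewrite -(subnK n3) addn3; move: (n - 3)%N => m.
rewrite /Stab /Fstar -(gauss_exp_first3 m); apply: eq_gauss_exp => x.
rewrite -(gauss_exp_first3 m); apply: eq_gauss_exp => z; rewrite lincomb10.
congr (dotv _ (normalize _)); apply: eq_from_tnth => i.
have im3 : (i < m.+3)%N by rewrite (leq_trans (ltn_ord i)).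
rewrite !tnth_mktuple -(tnth_nth 0 _ (Ordinal im3)) tnth_mktuple.
by rewrite !(tnth_nth 0).
Qed.

End normalization.

Section unit_vectors.
Context {R : realType} (n : nat).
Implicit Types x y : n.+1.-tuple R.

Definition unitv x : n.+1.-tuple R :=
  if normv x == 0 then [tuple (i == ord0)%:R | i < n.+1] else normalize x.

Lemma dotv_unitv_self x : dotv (unitv x) (unitv x) = 1.
Proof.
rewrite /unitv; case: ifPn => x0; last by rewrite dotv_normalize_self x0.
rewrite /dotv big_ord_recl !tnth_mktuple eqxx mulr1 big1 ?addr0// => i _.
by rewrite !tnth_mktuple mul0r.
Qed.

Lemma normv_unitv x : normv (unitv x) = 1.
Proof. exact/normv_eq1/dotv_unitv_self. Qed.

Lemma dotv_polarl x y : dotv x y = normv x * dotv (unitv x) y.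
Proof.
rewrite /unitv; case: ifPn => [|x0]; rewrite mulr_sumr.
  rewrite normv_eq0 => /eqP x0; apply: eq_bigr => i _.
  by rewrite (dotv_eq0_tnth _ x0) /normv x0 sqrtr0 !mul0r.
apply: eq_bigr => i _; rewrite tnth_mktuple mulrA.
by rewrite [normv x * _]mulrC mulfVK.
Qed.

Lemma dotv_polar x y :
  dotv x y = normv x * normv y * dotv (unitv x) (unitv y).
Proof. by rewrite dotv_polarl dotvC dotv_polarl dotvC mulrA. Qed.

Lemma exists_unit_dotv_le x y : dotv x x <= 1 ->
  exists2 w : n.+1.-tuple R, normv w = 1 & dotv w y <= dotv x y.
Proof.
rewrite -normv_le1 dotv_polarl; have := normv_ge0 x; move: (normv x) => r r0 r1.
have [t0|t0] := leP (dotv (unitv x) y) 0.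
  by exists (unitv x); [exact: normv_unitv|nra].
exists [tuple - 1 * tnth (unitv x) i | i < n.+1]; last by rewrite dotvZl; nra.
by apply/normv_eq1; rewrite dotvZl dotvZr dotv_unitv_self; ring.
Qed.

End unit_vectors.

Section graph_values.
Context {R : realType} (V : finType) (G : @wgraph R V).

Definition edge_corr d (f : V -> d.-tuple R) : R :=
  \sum_(u : V) \sum_(v : V) wt G u v * dotv (f u) (f v).

Lemma prod_valE d (f : V -> d.-tuple R) :
  prod_val G f = 4^-1 * (1 - edge_corr f).
Proof.
transitivity (4^-1 * (\sum_u \sum_v wt G u v - edge_corr f));
  last by rewrite wt_sum1.
rewrite -sumrB mulr_sumr; apply: eq_bigr => u _.
by rewrite -sumrB mulr_sumr; apply: eq_bigr => v _; ring.
Qed.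

Lemma edge_corr_ball_bound d (f : V -> d.-tuple R) :
  (forall v, dotv (f v) (f v) <= 1) -> -1 <= edge_corr f <= 1.
Proof.
move=> f1; rewrite -ler_norml -[leRHS](wt_sum1 G).
apply: (le_trans (ler_norm_sum _ _ _)); apply: ler_sum => u _.
apply: (le_trans (ler_norm_sum _ _ _)); apply: ler_sum => v _.
rewrite normrM (ger0_norm (wt_ge0 G u v)) ler_piMr ?wt_ge0//.
by rewrite ler_norml; exact: dotv_ball_bound.
Qed.

Lemma edge_corr_zero d : edge_corr (fun=> [tuple 0 | i < d]) = 0.
Proof. by apply: big1 => u _; apply: big1 => v _; rewrite dotv0l mulr0. Qed.

(* There are no loops, so the value is affine in the vector of each vertex. *)
Lemma edge_corr_update d (f : V -> d.-tuple R) v0 : exists c (y : d.-tuple R),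
  forall x, edge_corr [eta f with v0 |-> x] = c + 2 * dotv x y.
Proof.
exists (\sum_(u | u != v0) \sum_(v | v != v0) wt G u v * dotv (f u) (f v)).
exists [tuple \sum_(v | v != v0) wt G v0 v * tnth (f v) i | i < d] => x.
have -> : dotv x [tuple \sum_(v | v != v0) wt G v0 v * tnth (f v) i | i < d] =
    \sum_(v | v != v0) wt G v0 v * dotv x (f v).
  rewrite /dotv; under eq_bigr do rewrite tnth_mktuple mulr_sumr.
  rewrite exchange_big; apply: eq_bigr => v _ /=; rewrite mulr_sumr.
  by apply: eq_bigr => i _; ring.
rewrite /edge_corr (bigD1 v0)//= (bigD1 v0)//= eqxx wt_noloop mul0r add0r.
under [X in _ + X = _]eq_bigr => u /negPf uv0.
  by rewrite (bigD1 v0)//= eqxx uv0; over.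
rewrite big_split /= addrA addrC; congr (_ + _).
  apply: eq_bigr => u /negPf uv0; apply: eq_bigr => v /negPf vv0.
  by rewrite vv0.
rewrite mulr_natl mulr2n; congr (_ + _); apply: eq_bigr => v /negPf vv0.
  by rewrite vv0.
by rewrite wt_sym dotvC.
Qed.

Lemma prod_val_le_sphere d (f : V -> d.+1.-tuple R) :
  (forall v, dotv (f v) (f v) <= 1) ->
  exists2 f' : V -> d.+1.-tuple R, forall v, normv (f' v) = 1 &
    prod_val G f <= prod_val G f'.
Proof.
move=> f1.
suff [f' [_ f'1 ff']] : exists f' : V -> d.+1.-tuple R,
    [/\ forall v, dotv (f' v) (f' v) <= 1,
        {in enum V, forall v, normv (f' v) = 1} &
        prod_val G f <= prod_val G f'].
  by exists f' => // v; rewrite f'1// mem_enum.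
elim: (enum V) => [|v0 s [g [g1 gs fg]]]; first by exists f.
have [c [y edge_corrE]] := edge_corr_update g v0.
have [w w1 wy] := exists_unit_dotv_le y (g1 v0).
exists [eta g with v0 |-> w]; split.
- move=> v /=; case: ifP => // _; by rewrite -normv_le1 w1.
- by move=> v; rewrite inE /=; case: eqVneq => //= _; exact: gs.
- apply: (le_trans fg); rewrite !prod_valE edge_corrE ler_pM2l//.
  have -> : g = [eta g with v0 |-> g v0].
    by apply/funext => v /=; case: eqP => [->|].
  by rewrite edge_corrE; lra.
Qed.

Definition max_val d : R :=
  sup [set prod_val G f | f in
    [set f : V -> d.-tuple R | forall v, normv (f v) = 1]].

Lemma prod_val_le_max d (f : V -> d.+1.-tuple R) :
  (forall v, dotv (f v) (f v) <= 1) -> prod_val G f <= max_val d.+1.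
Proof.
move=> /prod_val_le_sphere[f' f'1 ff']; apply: (le_trans ff').
apply: ub_le_sup; last by exists f'.
exists 2^-1 => _ [g /= g1 <-]; rewrite prod_valE.
have /edge_corr_ball_bound/andP[] : forall v, dotv (g v) (g v) <= 1;
  last by lra.
by move=> v; rewrite -normv_le1 g1.
Qed.

Lemma max_val_le d M :
  (forall f : V -> d.+1.-tuple R,
    (forall v, normv (f v) = 1) -> prod_val G f <= M) ->
  max_val d.+1 <= M.
Proof.
move=> fM; apply: ge_sup => [|_ [f /= f1 <-]]; last exact: fM.
pose f (_ : V) := unitv [tuple (0 : R) | i < d.+1].
by exists (prod_val G f), f => // v; exact: normv_unitv.
Qed.

Lemma max_val_gt0 d : 0 < max_val d.+1.
Proof.
apply: lt_le_trans (prod_val_le_max (f := fun=> [tuple 0 | i < d.+1]) _).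
  by rewrite prod_valE edge_corr_zero subr0 mulr1.
by move=> v; rewrite dotv0l.
Qed.

Lemma card_wgraph_gt0 : (0 < #|V|)%N.
Proof.
rewrite lt0n; apply/negP => /eqP/card0_eq V0.
have := wt_sum1 G; rewrite big_pred0; first by move/esym/eqP; rewrite oner_eq0.
by move=> u; have := V0 u.
Qed.

Lemma SDP_ProdE : SDP_Prod G = max_val #|V|.-1.+1.
Proof. by rewrite prednK ?card_wgraph_gt0. Qed.

Lemma SDP_Prod_gt0 : 0 < SDP_Prod G.
Proof. by rewrite SDP_ProdE max_val_gt0. Qed.

End graph_values.

Section gaussian_rounding.
Context {R : realType} (V : finType) (G : @wgraph R V).

Lemma approx_ratio_ge0 (rho : R) : -1 <= rho < 1 ->
  0 <= (1 - Fstar 3 rho) / (1 - rho).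
Proof.
by move=> rho1; rewrite divr_ge0// subr_ge0; [exact: Fstar_le1|lra].
Qed.

Lemma alpha_BOV_ge0 : 0 <= @alpha_BOV R.
Proof.
apply: lb_le_inf; first by exists ((1 - Fstar 3 0) / (1 - 0)), 0 => //=; lra.
by move=> _ [rho /= rho1 <-]; exact: approx_ratio_ge0.
Qed.

Lemma alpha_BOV_le (rho : R) : -1 <= rho <= 1 ->
  alpha_BOV * (1 - rho) <= 1 - Fstar 3 rho.
Proof.
move=> /andP[rho0]; rewrite le_eqVlt => /predU1P[->|rho1].
  by rewrite subrr mulr0 subr_ge0 Fstar_le1.
rewrite -ler_pdivlMr ?subr_gt0//; apply: ge_inf;
  last by exists rho; rewrite //= rho0.
by exists 0 => _ [r /= r1 <-]; exact: approx_ratio_ge0.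
Qed.

Definition gauss_round k m (g : V -> m.-tuple R)
    (Z : m.-tuple (k.-tuple (measurableTypeR R))) (v : V) : k.-tuple R :=
  normalize (colcomb (g v) Z).

Lemma expect_gauss_round k m (g : V -> m.-tuple R) :
  (forall v, normv (g v) = 1) ->
  bmeas (fun Z => edge_corr G (gauss_round (k := k) g Z)) /\
  \E (tuple_prob (gauss k) m) (fun Z => edge_corr G (gauss_round g Z)) =
  \sum_u \sum_v wt G u v * Fstar k (dotv (g u) (g v)).
Proof.
move=> g1; have bdot u v : bmeas (fun Z =>
    dotv (gauss_round (k := k) g Z u) (gauss_round g Z v)).
  exact: (bmeas_comp (@bmeas_cos_angle R k) (measurable_colcomb2 _ _)).
have bwdot u := bmeas_sum _ (fun v => bmeasZ (wt G u v) (bdot u v)).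
split; first exact: bmeas_sum.
rewrite expect_sum//; apply: eq_bigr => u _.
rewrite expect_sum => [|v]; last exact: bmeasZ.
apply: eq_bigr => v _; rewrite expectZ// FstarE; congr (_ * _).
exact: (bexpect_transports (transports_colcomb k (g1 u) (g1 v))
  (@bmeas_cos_angle R k)).
Qed.

Lemma alpha_BOV_prod_val_le m (g : V -> m.-tuple R) :
  (forall v, normv (g v) = 1) ->
  alpha_BOV * prod_val G g <= Prod G.
Proof.
move=> g1; have [bround roundE] := expect_gauss_round 3 g1.
pose P := tuple_prob (@gauss R 3) m.
have bN : bmeas (fun Z => - edge_corr G (gauss_round (k := 3) g Z)).
  by under eq_fun do rewrite -mulN1r; exact: bmeasZ.
have [Z leZ] := exists_ge_expect P bN.
apply: (@le_trans _ _ (prod_val G (gauss_round g Z))); last first.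
  by apply: prod_val_le_max => v; exact: dotv_normalize_le1.
rewrite !prod_valE mulrCA ler_pM2l//.
apply: (@le_trans _ _
    (1 - \sum_u \sum_v wt G u v * Fstar 3 (dotv (g u) (g v)))).
  rewrite -[1 in leRHS](wt_sum1 G) -[1](wt_sum1 G) -!sumrB mulr_sumr.
  apply: ler_sum => u _; rewrite -!sumrB mulr_sumr; apply: ler_sum => v _.
  have [/normv_eq1 u1 /normv_eq1 v1] := (g1 u, g1 v).
  have : -1 <= dotv (g u) (g v) <= 1 by apply: dotv_ball_bound; rewrite ?u1 ?v1.
  by move=> /alpha_BOV_le/(ler_wpM2l (wt_ge0 G u v)); lra.
rewrite -roundE -/P; move: leZ.
under eq_expect do rewrite -mulN1r.
by rewrite expectZ// mulN1r; lra.
Qed.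

Lemma alpha_BOV_le_ratio : alpha_BOV <= Prod G / SDP_Prod G.
Proof.
rewrite ler_pdivlMr ?SDP_Prod_gt0//.
have := @alpha_BOV_ge0; rewrite le_eqVlt => /predU1P[<-|a0].
  by rewrite mul0r ltW// max_val_gt0.
rewrite mulrC -ler_pdivlMr// SDP_ProdE; apply: max_val_le => g g1.
by rewrite ler_pdivlMr// mulrC; exact: alpha_BOV_prod_val_le.
Qed.

End gaussian_rounding.

Section gaussian_moments.
Context {R : realType}.
Local Notation mR := (measurableTypeR R).
Local Notation V n := (n.-tuple mR).

(* x^2 exp(-x^2/2) <= (8/3) exp(-x^2/8), because y <= exp y at y = 3x^2/8. *)
Lemma sqr_normal_pdf_le (x : R) : x ^+ 2 * normal_pdf 0 1 x <=
  8 / 3 * (normal_peak 1 / normal_peak 2) * normal_pdf 0 2 x.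
Proof.
have p2 : normal_peak 2 != 0 :> R.
  by rewrite gt_eqF// normal_peak_gt0// pnatr_eq0.
rewrite !normal_pdfE ?oner_eq0 ?pnatr_eq0//.
have -> : 8 / 3 * (normal_peak 1 / normal_peak 2) *
    (normal_peak 2 * normal_fun 0 2 x) =
    normal_peak 1 * (8 / 3 * normal_fun 0 2 x) by field.
rewrite mulrCA ler_wpM2l ?normal_peak_ge0// /normal_fun subr0.
have -> : - x ^+ 2 / (1 ^+ 2 *+ 2) = - x ^+ 2 / (2 ^+ 2 *+ 2) - 3 / 8 * x ^+ 2.
  by field.
rewrite expRD expRN [leLHS]mulrCA mulrC ler_wpM2r ?expR_ge0//.
rewrite ler_pdivrMr ?expR_gt0//.
by have := expR_ge1Dx (3 / 8 * x ^+ 2); lra.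
Qed.

Lemma integrable_sqr_gauss1 :
  gauss1.-integrable [set: mR] (EFin \o (fun x : mR => x ^+ 2)).
Proof.
have mpdf s : measurable_fun [set: mR] (EFin \o normal_pdf 0 s).
  by apply/measurable_EFinP; exact: measurable_normal_pdf.
have msqr : measurable_fun [set: mR] (EFin \o (fun x : mR => x ^+ 2)).
  by apply/measurable_EFinP; exact: measurable_funX.
apply/integrableP; split=> //.
under eq_integral do rewrite gee0_abs ?lee_fin ?sqr_ge0//.
rewrite ge0_integral_normal_prob//; last by move=> x; rewrite lee_fin sqr_ge0.
pose C : R := 8 / 3 * (normal_peak 1 / normal_peak 2).
have C0 : 0 <= C by rewrite mulr_ge0// divr_ge0// normal_peak_ge0.
apply: (@le_lt_trans _ _
    (\int[@lebesgue_measure R]_x (C%:E * (normal_pdf 0 2 x)%:E))%E).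
  apply: ge0_le_integral => //.
  - by move=> x _; rewrite -EFinM lee_fin mulr_ge0 ?sqr_ge0 ?normal_pdf_ge0.
  - by apply: emeasurable_funM => //; exact: mpdf.
  - by apply: emeasurable_funM => //; exact: mpdf.
  - by move=> x _; rewrite -!EFinM lee_fin sqr_normal_pdf_le.
rewrite ge0_integralZl//; [|exact: mpdf|].
  by rewrite integral_normal_pdf mule1 ltry.
by move=> x _; rewrite lee_fin normal_pdf_ge0.
Qed.

Lemma integrable_norm_gauss1 :
  gauss1.-integrable [set: mR] (EFin \o (fun x : mR => `|x|)).
Proof.
have int_cst1 := bmeas_integrable (@gauss1 R) (bmeas_cst _ 1).
have int_sum := integrableD measurableT int_cst1 integrable_sqr_gauss1.
apply: le_integrable int_sum => //.
  apply/measurable_EFinP.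
  exact: (measurableT_comp (@normr_measurable R setT)).
move=> x _; rewrite -EFinD lee_fin normr_id (le_trans _ (ler_norm _))//.
by rewrite -[x ^+ 2]real_normK ?num_real//; have := sqr_ge0 (`|x| - 1); nra.
Qed.

Definition norm1 k (x : V k) : R := \sum_(i < k) `|tnth x i|.

Lemma integrable_norm1_gauss k :
  (gauss k).-integrable [set: V k] (EFin \o @norm1 k).
Proof.
rewrite (_ : EFin \o _ = fun x : V k => (\sum_(i < k) `|tnth x i|%:E)%E);
  last first.
  by apply/funext => x /=; rewrite sumEFin.
apply: integrable_sum => // i _.
exact: (integrable_transports (transports_tnth gauss1 i)
  integrable_norm_gauss1).
Qed.

End gaussian_moments.

Section tensor_power.
Context {R : realType}.

Lemma exprn_pow2_bounded_le1 (q C : R) :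
  0 <= q -> (forall j, q ^+ (2 ^ j) <= C) -> q <= 1.
Proof.
move=> q0 qC; rewrite leNgt; apply/negP => q1.
have qgt0 : 0 < q := lt_trans ltr01 q1.
have C0 : 0 < C by apply: lt_le_trans (qC 0%N); rewrite expr1.
have qV1 : `|q^-1| < 1 by rewrite gtr0_norm ?invr_gt0// invf_lt1.
have CV0 : 0 < C^-1 by rewrite invr_gt0.
have [N _ /(_ N (leqnn N))] := cvgr_lt _ (cvg_expr qV1) _ CV0.
rewrite /= exprVn ltf_pV2 ?posrE ?exprn_gt0// ltNge => /negP; apply.
by apply: le_trans (qC N); rewrite ler_weXn2l ?(ltW q1)// ltnW// ltn_expl.
Qed.

(* T(r)^N <= T(r^N) <= C r^N for N = 2^j, and N tends to infinity. *)
Lemma tensor_power_le_id (T : R -> R) (C : R) :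
  (forall r, 0 <= r <= 1 -> T r ^+ 2 <= T (r ^+ 2)) ->
  (forall r, 0 <= r <= 1 -> T r <= C * r) ->
  forall r, 0 <= r <= 1 -> T r <= r.
Proof.
move=> T2 TC r /[dup] r01 /andP[r0 r1].
have [t0|t0] := leP (T r) 0; first exact: le_trans t0 r0.
have rgt0 : 0 < r.
  rewrite lt_neqAle r0 andbT eq_sym; apply: contraTneq t0 => r_eq0.
  by rewrite -leNgt (le_trans (TC r r01))// r_eq0 mulr0.
have rX N : 0 <= r ^+ N <= 1 by rewrite exprn_ge0//= exprn_ile1.
have powle j : T r ^+ (2 ^ j) <= T (r ^+ (2 ^ j)).
  elim: j => [|j IH]; first by rewrite !expr1.
  rewrite expnSr !exprM; apply: le_trans (T2 _ (rX _)).
  have Tr0 : 0 <= T r ^+ (2 ^ j) by exact/exprn_ge0/ltW.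
  by rewrite lerXn2r// nnegrE (le_trans Tr0 IH).
rewrite -[leRHS]mul1r -ler_pdivrMr//.
apply: (@exprn_pow2_bounded_le1 _ C) => [|j]; first by rewrite divr_ge0// ltW.
rewrite expr_div_n ler_pdivrMr ?exprn_gt0//.
exact: le_trans (powle j) (TC _ (rX _)).
Qed.

End tensor_power.

Section gebelein.
Context {R : realType} (k : nat).
Local Notation mR := (measurableTypeR R).
Local Notation V n := (n.-tuple mR).
Implicit Types (h : V k -> R) (rho : R).

Definition noise_stab rho h : R :=
  \E (corr_gauss k rho) (fun p => h p.1 * h p.2).

Definition noise_op rho h (x : V k) : R :=
  \E (gauss k) (fun y => h (lincomb rho x (Num.sqrt (1 - rho ^+ 2)) y)).

Lemma bmeas_noise_op rho h : bmeas h -> bmeas (noise_op rho h).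
Proof.
move=> bh; pose f (p : V k * V k) :=
  h (lincomb rho p.1 (Num.sqrt (1 - rho ^+ 2)) p.2).
have bf : bmeas f by apply: (bmeas_comp bh); exact: measurable_lincomb.
exact: (bmeas_expect (gauss k) bf).
Qed.

Lemma bmeas_tensor h : bmeas h -> bmeas (fun p : V k * V k => h p.1 * h p.2).
Proof. by move=> bh; apply: bmeasM; apply: (bmeas_comp bh). Qed.

Lemma bmeas_lincombl a b h (x : V k) : bmeas h ->
  bmeas (fun y => h (lincomb a x b y)).
Proof. by move=> bh; apply: (bmeas_comp bh); exact: measurable_lincomb. Qed.

Lemma noise_stabE rho h : bmeas h ->
  noise_stab rho h = \E (gauss k) (fun x => h x * noise_op rho h x).
Proof.
move=> bh; rewrite /noise_stab (expect_corr_gauss _ (bmeas_tensor bh)).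
by apply: eq_expect => x; rewrite /noise_op -expectZ//; exact: bmeas_lincombl.
Qed.

(* Two noisy copies of the same x are rho^2-correlated. *)
Lemma expect_sqr_noise_op rho h : -1 <= rho <= 1 -> bmeas h ->
  \E (gauss k) (fun x => noise_op rho h x ^+ 2) = noise_stab (rho ^+ 2) h.
Proof.
move=> rho1 bh; set s := Num.sqrt (1 - rho ^+ 2).
have s2 : s ^+ 2 = 1 - rho ^+ 2 := sqr_sqrt_onem_sqr rho1.
have [a [b [c [chol triE]]]] := exists_tri_gauss_lincomb k rho rho s 0 s.
have {}chol : is_cholesky a b c 1 (rho ^+ 2) 1.
  move: chol; rewrite mulr0 addr0 s2 expr0n add0r subrKC.
  by rewrite -expr2.
have [aE bE cE] := is_cholesky_unit chol.
have -> : noise_stab (rho ^+ 2) h =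
    \E (tri_gauss k a b c) (fun p => h p.1 * h p.2) by rewrite aE bE cE.
rewrite -(triE _ (bmeas_tensor bh)).
apply: eq_expect => x; rewrite expect_tri_gauss; last first.
  by apply: (bmeas_lincomb_pair rho 1 rho 1 _ _ _ _ (bmeas_tensor bh)).
rewrite expr2 -expectZ; last exact: bmeas_lincombl.
apply: eq_expect => y; rewrite mulrC -expectZ; last exact: bmeas_lincombl.
apply: eq_expect => z; congr (h _ * h _);
  by apply: eq_from_tnth => i; rewrite !tnth_mktuple -/s; ring.
Qed.

Lemma noise_stab_sqr_le rho h : -1 <= rho <= 1 -> bmeas h ->
  noise_stab rho h ^+ 2 <=
  \E (gauss k) (fun x => h x ^+ 2) * noise_stab (rho ^+ 2) h.
Proof.
move=> rho1 bh; rewrite noise_stabE// -expect_sqr_noise_op//.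
exact: expect_cauchy_schwarz (bmeas_noise_op rho bh).
Qed.

Section lipschitz.
Variables (h : V k -> R) (L M : R).
Hypotheses (mh : measurable_fun [set: V k] h) (hM : forall x, `|h x| <= M).
Hypothesis h_lip : forall x y,
  `|h x - h y| <= L * \sum_(i < k) `|tnth x i - tnth y i|.
Hypotheses (L0 : 0 <= L) (h_mean0 : \E (gauss k) h = 0).

Let bh : bmeas h. Proof. by split=> //; exists M. Qed.

Lemma noise_op_lipschitz rho x : 0 <= rho ->
  `|noise_op rho h x - noise_op rho h [tuple 0 | i < k]| <= L * (rho * norm1 x).
Proof.
move=> rho0; rewrite /noise_op -expectB; do ?exact: bmeas_lincombl.
apply: norm_expect_le => [|y].
  by apply: bmeas_measurable; apply: bmeasB; exact: bmeas_lincombl.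
apply: (le_trans (h_lip _ _)); rewrite ler_wpM2l// le_eqVlt mulr_sumr.
apply/orP; left; apply/eqP/eq_bigr => i _; rewrite !tnth_mktuple.
by rewrite mulr0 add0r addrK normrM ger0_norm.
Qed.

Lemma noise_stab_le_linear rho : 0 <= rho ->
  noise_stab rho h <= M * L * \E (gauss k) (@norm1 R k) * rho.
Proof.
move=> rho0; have bT := bmeas_noise_op rho bh.
set T0 := noise_op rho h [tuple 0 | i < k].
have M0 : 0 <= M := le_trans (normr_ge0 _) (hM [tuple 0 | i < k]).
have bT0 : bmeas (fun x => noise_op rho h x - T0) by exact/bmeasB/bmeas_cst.
have -> : noise_stab rho h =
    \E (gauss k) (fun x => h x * (noise_op rho h x - T0)).
  under eq_expect do rewrite mulrBr [h _ * T0]mulrC.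
  by rewrite expectB ?expectZ ?h_mean0 ?mulr0 ?subr0 ?noise_stabE//;
    [exact: bmeasM|exact: bmeasZ].
have int_norm1 := integrableZl measurableT (M * L * rho)
  (@integrable_norm1_gauss R k).
have -> : M * L * \E (gauss k) (@norm1 R k) * rho =
    \E (gauss k) (fun x => M * L * rho * norm1 x).
  by rewrite RintegralZl//; [ring|exact: integrable_norm1_gauss].
apply: le_Rintegral => //; first exact/bmeas_integrable/bmeasM.
move=> x _; rewrite (le_trans (ler_norm _))// normrM -!mulrA ler_pM//.
exact: noise_op_lipschitz.
Qed.

Lemma gebelein_lipschitz rho : 0 <= rho <= 1 ->
  noise_stab rho h <= rho * \E (gauss k) (fun x => h x ^+ 2).
Proof.
move=> rho01; set E := \E _ _.
have sqr_le r : 0 <= r <= 1 -> noise_stab r h ^+ 2 <= E * noise_stab (r ^+ 2) h.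
  by move=> r01; apply: noise_stab_sqr_le => //; lra.
have : 0 <= E by apply: expect_ge0 => x; exact: sqr_ge0.
rewrite le_eqVlt => /predU1P[E0|E0].
  have : noise_stab rho h ^+ 2 == 0.
    by have := sqr_le _ rho01; rewrite eq_le sqr_ge0 andbT -E0 mul0r.
  by rewrite sqrf_eq0 -E0 mulr0 => /eqP ->.
rewrite -ler_pdivrMr//.
apply: (@tensor_power_le_id _ (fun r => noise_stab r h / E)
  (M * L * \E (gauss k) (@norm1 R k) / E)) => [r r01|r /andP[r0 _]|//].
  rewrite expr_div_n ler_pdivrMr ?exprn_gt0// (le_trans (sqr_le r r01))//.
  by rewrite expr2 mulrA divfK ?gt_eqF// mulrC.
by rewrite mulrAC ler_pM2r ?invr_gt0//; exact: noise_stab_le_linear.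
Qed.

End lipschitz.
End gebelein.

Section smoothed_direction.
Context {R : realType} (k : nat).
Local Notation mR := (measurableTypeR R).
Local Notation V n := (n.-tuple mR).
Implicit Types (x y : V k) (i : 'I_k) (del rho : R).

Definition smooth_norm del x : R := Num.sqrt (dotv x x + del).

Definition smooth_coord del i x : R := tnth x i / smooth_norm del x.

Lemma smooth_coord0 i x : smooth_coord 0 i x = tnth (normalize x) i.
Proof. by rewrite /smooth_coord /smooth_norm addr0 tnth_mktuple. Qed.

Lemma smooth_norm_gt0 del x : 0 < del -> 0 < smooth_norm del x.
Proof. by move=> d0; rewrite sqrtr_gt0 ltr_wpDl// dotv_ge0. Qed.

Lemma smooth_norm_sqr del x : 0 <= del ->
  smooth_norm del x ^+ 2 = dotv x x + del.
Proof. by move=> d0; rewrite sqr_sqrtr// addr_ge0// dotv_ge0. Qed.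

Lemma tnth_le_smooth_norm del x i : 0 <= del ->
  `|tnth x i| <= smooth_norm del x.
Proof.
move=> d0; rewrite -sqrtr_sqr ler_wsqrtr// (le_trans (sqr_tnth_le x i))//.
by rewrite lerDl.
Qed.

Lemma smooth_norm_lipschitz del x y : 0 < del ->
  `|smooth_norm del y - smooth_norm del x| <=
  \sum_(j < k) `|tnth x j - tnth y j|.
Proof.
move=> d0; have [A0 B0] := (smooth_norm_gt0 x d0, smooth_norm_gt0 y d0).
have BA0 : 0 < smooth_norm del y + smooth_norm del x by exact: addr_gt0.
rewrite -(ler_pM2r BA0) -{1}(gtr0_norm BA0) -normrM -subr_sqr.
rewrite !smooth_norm_sqr ?(ltW d0)// opprD addrACA subrr addr0 -sumrB mulr_suml.
apply: (le_trans (ler_norm_sum _ _ _)); apply: ler_sum => j _.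
have -> : tnth y j * tnth y j - tnth x j * tnth x j =
  (tnth y j - tnth x j) * (tnth y j + tnth x j) by ring.
rewrite normrM distrC ler_wpM2l// (le_trans (ler_normD _ _))//.
by apply: lerD; exact/tnth_le_smooth_norm/ltW.
Qed.

Lemma norm_smooth_coord_le1 del i x : 0 <= del -> `|smooth_coord del i x| <= 1.
Proof.
move=> d0; rewrite normrM normfV (ger0_norm (sqrtr_ge0 _)).
rewrite -/(smooth_norm del x).
have [->|A0] := eqVneq (smooth_norm del x) 0;
  first by rewrite invr0 mulr0 ler01.
rewrite ler_pdivrMr ?mul1r ?tnth_le_smooth_norm//.
by rewrite lt_neqAle eq_sym A0 sqrtr_ge0.
Qed.

Lemma measurable_smooth_coord del i : 0 <= del ->
  measurable_fun [set: V k] (smooth_coord del i).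
Proof.
move=> d0; apply: measurable_funM; first exact: measurable_tnth.
apply: measurable_invsqrt => [|x]; last by rewrite addr_ge0// dotv_ge0.
by apply: measurable_funD => //; exact: measurable_fun_dotv.
Qed.

Lemma bmeas_smooth_coord del i : 0 <= del -> bmeas (smooth_coord del i).
Proof.
move=> d0; split; first exact: measurable_smooth_coord.
by exists 1 => x; exact: norm_smooth_coord_le1.
Qed.

Lemma smooth_coord_lipschitz del i x y : 0 < del ->
  `|smooth_coord del i x - smooth_coord del i y| <=
  2 / Num.sqrt del * \sum_(j < k) `|tnth x j - tnth y j|.
Proof.
move=> d0; have [A0 B0] := (smooth_norm_gt0 x d0, smooth_norm_gt0 y d0).
have yB := norm_smooth_coord_le1 i y (ltW d0).
have := smooth_norm_lipschitz x y d0; set D := \sum_(j < k) _ => AB.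
have xyD : `|tnth x i - tnth y i| <= D.
  by rewrite /D (bigD1 i)//= lerDl sumr_ge0.
have AV : (smooth_norm del x)^-1 <= (Num.sqrt del)^-1.
  rewrite lef_pV2 ?posrE ?smooth_norm_gt0 ?sqrtr_gt0//.
  by rewrite ler_wsqrtr// lerDr dotv_ge0.
have -> : smooth_coord del i x - smooth_coord del i y = (tnth x i - tnth y i +
    smooth_coord del i y * (smooth_norm del y - smooth_norm del x)) /
    smooth_norm del x.
  by rewrite /smooth_coord; field; rewrite !gt_eqF.
rewrite normrM normfV (gtr0_norm A0) [leRHS]mulrAC.
rewrite ler_pM// ?invr_ge0 ?(ltW A0)//.
rewrite mulr_natl mulr2n (le_trans (ler_normD _ _))// lerD// normrM.
by rewrite -[leRHS]mul1r ler_pM.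
Qed.

Lemma cvg_smooth_coord i x :
  smooth_coord n.+1%:R^-1 i x @[n --> \oo] --> smooth_coord 0 i x.
Proof.
have [x0|x0] := eqVneq (dotv x x) 0.
  rewrite /smooth_coord (dotv_eq0_tnth i x0) mul0r.
  by under eq_fun do rewrite mul0r; exact: cvg_cst.
apply: cvgM; first exact: cvg_cst.
apply: cvgV.
  by rewrite /smooth_norm addr0 sqrtr_eq0 -ltNge lt_neqAle eq_sym x0 dotv_ge0.
have cvg_sqr : dotv x x + n.+1%:R^-1 @[n --> \oo] --> dotv x x + 0.
  by apply: cvgD; [exact: cvg_cst|exact: cvg_harmonic].
exact: (cvg_comp _ _ cvg_sqr (@sqrt_continuous R _)).
Qed.

Lemma smooth_coord_sqr_le del i x : 0 <= del ->
  smooth_coord del i x ^+ 2 <= smooth_coord 0 i x ^+ 2.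
Proof.
move=> d0; rewrite !expr_div_n !smooth_norm_sqr// addr0.
have [x0|x0] := eqVneq (dotv x x) 0.
  by rewrite (dotv_eq0_tnth i x0) expr0n !mul0r.
have xgt0 : 0 < dotv x x by rewrite lt_neqAle eq_sym x0 dotv_ge0.
by rewrite ler_wpM2l ?sqr_ge0// lef_pV2 ?posrE ?lerDl// ltr_pwDl.
Qed.

Lemma expect_gauss_odd (h : V k -> R) : bmeas h ->
  (forall x, h [tuple - tnth x i | i < k] = - h x) -> \E (gauss k) h = 0.
Proof.
move=> bh hN; have bh1 : bmeas (fun p : V k * V k => h p.1).
  by apply: (bmeas_comp bh).
have cs : (-1) ^+ 2 + 0 ^+ 2 = 1 :> R by ring.
rewrite -(bexpect_fst _ (gauss k) bh).
apply: (expect_anti_invariant (transports_vrotation k cs)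
  (bmeas_integrable _ bh1)) => p.
rewrite -hN /=; congr h.
by apply: eq_from_tnth => i; rewrite !tnth_mktuple mulN1r oppr0 mul0r addr0.
Qed.

Lemma expect_smooth_coord del i : 0 <= del ->
  \E (gauss k) (smooth_coord del i) = 0.
Proof.
move=> d0; apply: expect_gauss_odd => [|x]; first exact: bmeas_smooth_coord.
rewrite /smooth_coord tnth_mktuple mulNr; congr (- (_ / Num.sqrt (_ + _))).
by apply: eq_bigr => j _; rewrite !tnth_mktuple mulrNN.
Qed.

Lemma cvg_noise_stab_smooth_coord rho i :
  noise_stab rho (smooth_coord n.+1%:R^-1 i) @[n --> \oo] -->
  noise_stab rho (smooth_coord 0 i).
Proof.
have bt del : 0 <= del -> bmeas (fun p : V k * V k =>
    smooth_coord del i p.1 * smooth_coord del i p.2).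
  by move=> d0; exact/bmeas_tensor/bmeas_smooth_coord.
apply: (expect_dominated (g := fun=> 1)) => [n||//|n p|p].
- by apply: bmeas_measurable; exact: bt.
- by apply: bmeas_measurable; exact: bt.
- by apply: bmeas_integrable; exact: bmeas_cst.
- by rewrite normrM mulr_ile1// norm_smooth_coord_le1.
- by apply: cvgM; exact: cvg_smooth_coord.
Qed.

Lemma noise_stab_normalize_le rho i : 0 <= rho <= 1 ->
  noise_stab rho (smooth_coord 0 i) <=
  rho * \E (gauss k) (fun x => smooth_coord 0 i x ^+ 2).
Proof.
move=> rho01; apply: (cvgr_to_le (@cvg_noise_stab_smooth_coord rho i)).
apply: nearW => n; set del := n.+1%:R^-1.
have d0 : 0 < del :> R by rewrite invr_gt0.
have dge0 := ltW d0.
apply: (@le_trans _ _ (rho *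
  \E (gauss k) (fun x => smooth_coord del i x ^+ 2))).
  apply: (@gebelein_lipschitz _ _ _ (2 / Num.sqrt del) 1) => //.
  - exact: measurable_smooth_coord.
  - by move=> x; exact: norm_smooth_coord_le1.
  - by move=> x y; exact: smooth_coord_lipschitz.
  - exact: expect_smooth_coord.
rewrite ler_wpM2l//; first by case/andP: rho01.
apply: le_expect => [||x]; do ?by apply: bmeasX; exact: bmeas_smooth_coord.
exact: smooth_coord_sqr_le.
Qed.

Lemma Fstar_noise_stab rho :
  Fstar k rho = \sum_(i < k) noise_stab rho (smooth_coord 0 i).
Proof.
rewrite FstarE -expect_sum => [|i]; last exact/bmeas_tensor/bmeas_smooth_coord.
by apply: eq_expect => p; apply: eq_bigr => i _; rewrite !smooth_coord0.
Qed.

Lemma Fstar_le_id rho : 0 <= rho <= 1 -> Fstar k rho <= rho.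
Proof.
move=> rho01; rewrite Fstar_noise_stab.
apply: le_trans (ler_sum _ (fun i _ => noise_stab_normalize_le i rho01)) _.
have bsqr i : bmeas (fun x : V k => smooth_coord 0 i x ^+ 2).
  by apply: bmeasX; exact: bmeas_smooth_coord.
rewrite -mulr_sumr -expect_sum// ler_piMr//; first by case/andP: rho01.
rewrite -(expect_cst (gauss k) 1); apply: le_expect => [||x].
- exact: bmeas_sum.
- exact: bmeas_cst.
- apply: le_trans (dotv_normalize_le1 x).
  by apply: ler_sum => i _; rewrite smooth_coord0.
Qed.

Lemma noise_stab0 (h : V k -> R) : bmeas h ->
  noise_stab 0 h = \E (gauss k) h ^+ 2.
Proof.
move=> bh; rewrite noise_stabE// expr2 -expectZ//; apply: eq_expect => x.
rewrite mulrC; congr (_ * _); apply: eq_expect => y; congr h.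
rewrite expr0n subr0 sqrtr1.
by apply: eq_from_tnth => i; rewrite tnth_mktuple mul0r add0r mul1r.
Qed.

Lemma Fstar0_ge0 : 0 <= Fstar k (0 : R).
Proof.
rewrite Fstar_noise_stab; apply: sumr_ge0 => i _.
by rewrite noise_stab0 ?sqr_ge0//; exact: bmeas_smooth_coord.
Qed.

End smoothed_direction.

Section finite_valued_maps.
Context d (T : measurableType d).

Definition measurable_fibers (K : finType) (kap : T -> K) : Prop :=
  forall k, measurable (kap @^-1` [set k]).

Lemma measurable_fibers_preimage (K : finType) (kap : T -> K) (A : set K) :
  measurable_fibers kap -> measurable (kap @^-1` A).
Proof.
move=> mkap; rewrite (_ : _ @^-1` _ = \bigcup_(k in A) kap @^-1` [set k]).
  by apply: fin_bigcup_measurable => // ; exact: finite_finset.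
by apply/seteqP; split=> [x Ax|x [k Ak /= ->]]//; exists (kap x).
Qed.

Lemma measurable_fibers_comp (K K' : finType) (kap : T -> K) (f : K -> K') :
  measurable_fibers kap -> measurable_fibers (fun x => f (kap x)).
Proof.
by move=> mkap k; exact: (measurable_fibers_preimage (f @^-1` [set k])).
Qed.

Lemma measurable_fun_fibers (K : finType) d' (T' : measurableType d')
    (kap : T -> K) (f : K -> T') :
  measurable_fibers kap -> measurable_fun [set: T] (fun x => f (kap x)).
Proof.
move=> mkap _ A _; rewrite setTI.
exact: (measurable_fibers_preimage (f @^-1` A)).
Qed.

Lemma bmeas_fibers {R : realType} (K : finType) (kap : T -> K) (f : K -> R) :
  measurable_fibers kap -> bmeas (fun x => f (kap x)).
Proof.
move=> mkap; split; first exact: measurable_fun_fibers.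
exists (\sum_k `|f k|) => x; rewrite (bigD1 (kap x))//= lerDl; exact: sumr_ge0.
Qed.

End finite_valued_maps.

Lemma measurable_fibers_map_tuple d (T : measurableType d) (K : finType)
    (kap : T -> K) n : measurable_fibers kap ->
  measurable_fibers (fun x : n.-tuple T => map_tuple kap x).
Proof.
move=> mkap u; rewrite (_ : _ @^-1` _ =
    \bigcap_(i in [set: 'I_n])
      (fun x => tnth x i) @^-1` (kap @^-1` [set tnth u i])).
  apply: fin_bigcap_measurable => [|i _]; first exact: finite_finset.
  exact: measurable_preimage (measurable_tnth i) (mkap _).
apply/seteqP; split=> [x /= <- i _ /=|x ux]; first by rewrite tnth_map.
by apply: eq_from_tnth => i; rewrite tnth_map; exact: ux.
Qed.

Section joint_law.
Context {R : realType} d (T : measurableType d) (P : probability T R).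
Variables (V : finType) (a b : T -> V).
Hypotheses (ma : measurable_fibers a) (mb : measurable_fibers b).

Definition joint_law (u v : V) : R :=
  \E P (fun x => (a x == u)%:R * (b x == v)%:R).

Lemma joint_law_ge0 u v : 0 <= joint_law u v.
Proof. by apply: expect_ge0 => x; rewrite mulr_ge0. Qed.

Lemma sum_joint_law (F : V -> V -> R) :
  \sum_u \sum_v joint_law u v * F u v = \E P (fun x => F (a x) (b x)).
Proof.
have bind u v : bmeas (fun x => (a x == u)%:R * (b x == v)%:R : R).
  apply: bmeasM.
  - exact: (bmeas_fibers (fun k => (k == u)%:R) ma).
  - exact: (bmeas_fibers (fun k => (k == v)%:R) mb).
have bF u v := bmeasZ (F u v) (bind u v).
transitivity (\sum_u \sum_v
    \E P (fun x => F u v * ((a x == u)%:R * (b x == v)%:R))).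
  by apply: eq_bigr => u _; apply: eq_bigr => v _; rewrite expectZ// mulrC.
under eq_bigr do rewrite -expect_sum//.
rewrite -expect_sum => [|u]; last exact: bmeas_sum.
apply: eq_expect => x; rewrite (bigD1 (a x))//= (bigD1 (b x))//= !eqxx !mulr1.
rewrite !big1 ?addr0// => [u ua|v vb]; last by rewrite eq_sym (negPf vb) !mulr0.
by apply: big1 => v _; rewrite eq_sym (negPf ua) mul0r mulr0.
Qed.

End joint_law.

Section loop_removal.
Context {R : realType} (V : finType) (W : V -> V -> R).
Hypothesis W_ge0 : forall u v, 0 <= W u v.

Definition offdiag_mass : R := \sum_u \sum_(v | v != u) W u v.

Definition separation d (f : V -> d.-tuple R) : R :=
  \sum_u \sum_v W u v * (1 - dotv (f u) (f v)).

Lemma separation_le_offdiag_mass d (f : V -> d.-tuple R) :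
  (forall v, normv (f v) = 1) -> separation f <= 2 * offdiag_mass.
Proof.
move=> /(_ _)/normv_eq1 f1; rewrite mulr_sumr; apply: ler_sum => u _.
rewrite (bigD1 u)//= f1 subrr mulr0 add0r mulr_sumr; apply: ler_sum => v _.
rewrite mulrC ler_wpM2r//.
have : -1 <= dotv (f u) (f v) <= 1 by apply: dotv_ball_bound; rewrite f1.
by lra.
Qed.

Hypothesis mass_gt0 : 0 < offdiag_mass.

Definition offdiag_wt u v : R :=
  if u == v then 0 else (W u v + W v u) / (2 * offdiag_mass).

Lemma offdiag_wt_ge0 u v : 0 <= offdiag_wt u v.
Proof.
rewrite /offdiag_wt; case: ifP => // _.
by rewrite divr_ge0 ?addr_ge0// mulr_ge0// ltW.
Qed.

Lemma offdiag_wt_sym u v : offdiag_wt u v = offdiag_wt v u.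
Proof. by rewrite /offdiag_wt eq_sym addrC. Qed.

Lemma offdiag_wt_noloop u : offdiag_wt u u = 0.
Proof. by rewrite /offdiag_wt eqxx. Qed.

Lemma sum_offdiag_wt (F : V -> V -> R) :
  (forall u v, F u v = F v u) -> (forall u, F u u = 0) ->
  \sum_u \sum_v offdiag_wt u v * F u v =
  offdiag_mass^-1 * \sum_u \sum_v W u v * F u v.
Proof.
move=> Fsym F0; set c := offdiag_mass^-1.
transitivity (c / 2 *
    (\sum_u \sum_v W u v * F u v + \sum_u \sum_v W v u * F u v)).
  rewrite -big_split mulr_sumr; apply: eq_bigr => u _ /=.
  rewrite -big_split mulr_sumr; apply: eq_bigr => v _ /=; rewrite /offdiag_wt.
  by case: eqVneq => [->|_]; rewrite ?F0 ?invfM -/c; ring.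
rewrite [X in _ + X]exchange_big /=.
by under [X in _ + X]eq_bigr do under eq_bigr do rewrite Fsym; field.
Qed.

Lemma offdiag_wt_sum1 : \sum_u \sum_v offdiag_wt u v = 1.
Proof.
pose F (u v : V) : R := (v != u)%:R.
transitivity (\sum_u \sum_v offdiag_wt u v * F u v).
  apply: eq_bigr => u _; apply: eq_bigr => v _; rewrite /F eq_sym.
  by case: eqVneq => [->|_]; rewrite ?offdiag_wt_noloop ?mul0r ?mulr1.
rewrite sum_offdiag_wt => [|u v|u]; rewrite /F ?eqxx 1?eq_sym//.
rewrite (_ : \sum_u _ = offdiag_mass) ?mulVf ?gt_eqF//.
apply: eq_bigr => u _; rewrite [RHS]big_mkcond; apply: eq_bigr => v _.
by rewrite /F; case: (_ != _); rewrite ?mulr1 ?mulr0.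
Qed.

Definition offdiag_graph : wgraph V :=
  WGraph offdiag_wt_ge0 offdiag_wt_sym offdiag_wt_noloop offdiag_wt_sum1.

Lemma prod_val_offdiag_graph d (f : V -> d.-tuple R) :
  (forall v, normv (f v) = 1) ->
  prod_val offdiag_graph f = (4 * offdiag_mass)^-1 * separation f.
Proof.
move=> /(_ _)/normv_eq1 f1; rewrite invfM -mulrA -sum_offdiag_wt => [|u v|u].
- rewrite mulr_sumr; apply: eq_bigr => u _; rewrite mulr_sumr.
  by apply: eq_bigr => v _; rewrite /=; ring.
- by rewrite dotvC.
- by rewrite f1 subrr.
Qed.

End loop_removal.

Section graphs_from_couplings.
Context {R : realType}.

Definition padv n N (x : n.-tuple R) : N.-tuple R := [tuple nth 0 x i | i < N].

Lemma dotv_padv n N (x y : n.-tuple R) : (n <= N)%N ->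
  dotv (padv N x) (padv N y) = dotv x y.
Proof.
move=> nN; rewrite /dotv; under [RHS]eq_bigr do rewrite !(tnth_nth 0).
rewrite (big_ord_widen N (fun i => nth 0 x i * nth 0 y i) nN) [RHS]big_mkcond.
apply: eq_bigr => i _; rewrite !tnth_mktuple; case: ltnP => // ni.
by rewrite nth_default ?mul0r// size_tuple.
Qed.

Lemma prod_val_le_SDP (V : finType) (G : @wgraph R V) n (f : V -> n.-tuple R) :
  (n <= #|V|)%N -> (forall v, normv (f v) = 1) -> prod_val G f <= SDP_Prod G.
Proof.
move=> nV /(_ _)/normv_eq1 f1; rewrite SDP_ProdE.
pose g v := padv #|V|.-1.+1 (f v).
have gE u v : dotv (g u) (g v) = dotv (f u) (f v).
  by rewrite dotv_padv// prednK// (card_wgraph_gt0 G).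
rewrite (_ : prod_val G f = prod_val G g); last first.
  rewrite !prod_valE /edge_corr.
  by under [in RHS]eq_bigr do under eq_bigr do rewrite gE.
by apply: prod_val_le_max => v; rewrite gE f1.
Qed.

Lemma exists_graph_ratio_le (V : finType) (W : V -> V -> R) n
    (w : V -> n.-tuple R) (A B : R) :
  (forall u v, 0 <= W u v) -> (n <= #|V|)%N -> (forall v, normv (w v) = 1) ->
  0 < A -> A <= separation W w ->
  (forall f : V -> 3.-tuple R, (forall v, normv (f v) = 1) ->
    separation W f <= B) ->
  exists G : @wgraph R V, Prod G / SDP_Prod G <= B / A.
Proof.
move=> W_ge0 nV w1 A0 Aw Bf.
have mass_gt0 : 0 < offdiag_mass W.
  by have := separation_le_offdiag_mass W_ge0 w1; lra.
pose G := offdiag_graph W_ge0 mass_gt0; set c := (4 * offdiag_mass W)^-1.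
have c0 : 0 < c by rewrite invr_gt0 mulr_gt0.
exists G; rewrite ler_pdivrMr ?SDP_Prod_gt0//.
have SDP_ge : c * A <= SDP_Prod G.
  apply: le_trans (prod_val_le_SDP G nV w1).
  by rewrite prod_val_offdiag_graph// ler_pM2l.
have Prod_le : Prod G <= c * B.
  apply: max_val_le => f f1; rewrite prod_val_offdiag_graph// ler_pM2l//.
  exact: Bf.
have B0 : 0 <= B.
  by rewrite -(pmulr_rge0 _ c0) (le_trans _ Prod_le)// ltW// (max_val_gt0 G 2).
apply: (le_trans Prod_le); rewrite mulrAC ler_pdivlMr//.
have -> : c * B * A = B * (c * A) by ring.
by rewrite ler_wpM2l.
Qed.

End graphs_from_couplings.

Section quantization.
Context {R : realType}.
Local Notation mR := (measurableTypeR R).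
Local Notation gauss2 := (@gauss1 R \x gauss1)%E.

Import HBNNSimple.

Lemma simple_approximation : exists Q : nat -> mR -> mR,
  [/\ forall n, measurable_fun [set: mR] (Q n),
      forall n, finite_set (range (Q n)),
      forall n x, `|Q n x| <= `|x| & forall x, Q n x @[n --> \oo] --> x].
Proof.
have mnorm : measurable_fun [set: mR] (EFin \o (fun x : mR => `|x|)).
  apply/measurable_EFinP.
  exact: (measurableT_comp (@normr_measurable R setT)).
have norm0 (x : mR) : [set: mR] x -> (0 <= `|x|%:E :> \bar R)%E.
  by rewrite lee_fin.
pose f := nnsfun_approx measurableT mnorm.
have f_le n x : 0 <= f n x <= `|x|.
  by rewrite fun_ge0 /= -lee_fin nnsfun_approxE; apply: le_approx.
have f_cvg x : f n x @[n --> \oo] --> `|x|.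
  exact: (fine_cvg (cvg_nnsfun_approx measurableT mnorm norm0 I)).
have mf n : measurable_fun [set: mR] (f n : mR -> mR) := measurable_funPT (f n).
exists (fun n (x : mR) => if 0 <= x :> R then f n x else - f n x).
split=> [n|n|n x|x].
- apply: measurable_fun_ifT => //; first exact: measurable_fun_ler.
  exact: (measurableT_comp (@oppr_measurable R setT)).
- apply: (sub_finite_set (B := range (f n) `|` -%R @` range (f n))).
    move=> _ [x _ <-]; case: ifP => _; first by left; exists x.
    by right; exists (f n x) => //; exists x.
  rewrite finite_setU; split; first exact: fimfunP.
  exact/finite_image/fimfunP.
- have /andP[f0 fx] := f_le n x.
  by case: ifP => _; rewrite ?normrN ger0_norm.
- case: (lerP 0 x) => x0; first by rewrite -[X in _ --> X]ger0_norm.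
  by rewrite -[X in _ --> X]opprK -(ltr0_norm x0); exact: cvgN.
Qed.

Lemma finite_range_factor (Q : mR -> mR) :
  measurable_fun [set: mR] Q -> finite_set (range Q) ->
  exists (K : finType) (kap : mR -> K) (q : K -> R),
  measurable_fibers kap /\ forall x, Q x = q (kap x).
Proof.
move=> mQ /finite_seqP[r rE].
have Qr x : Q x \in r by have : range Q (Q x) by [exists x]; rewrite rE.
exists (seq_sub r), (fun x => SeqSub (Qr x)), val; split=> // k.
rewrite (_ : _ @^-1` _ = Q @^-1` [set val k]); last first.
  by apply/seteqP; split=> [x <-|x Qx]//; exact: val_inj.
exact: measurable_preimage.
Qed.

Lemma integrable_sqr_fst :
  gauss2.-integrable [set: mR * mR] (EFin \o (fun p => p.1 ^+ 2)).
Proof.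
exact: (integrable_transports (transports_fst gauss1 gauss1)
  integrable_sqr_gauss1).
Qed.

Lemma integrable_sqr_snd :
  gauss2.-integrable [set: mR * mR] (EFin \o (fun p => p.2 ^+ 2)).
Proof.
exact: (integrable_transports (transports_snd gauss1 gauss1)
  integrable_sqr_gauss1).
Qed.

Lemma integrable_quadratic (C : R) (f : mR * mR -> R) :
  measurable_fun [set: mR * mR] f ->
  (forall p, `|f p| <= C * (p.1 ^+ 2 + p.2 ^+ 2)) ->
  gauss2.-integrable [set: mR * mR] (EFin \o f).
Proof.
move=> mf fC; apply: (le_integrable _ _ _ (integrableZl measurableT C
    (integrableD measurableT integrable_sqr_fst integrable_sqr_snd))) => //.
  exact/measurable_EFinP.
by move=> p _; rewrite lee_fin (le_trans (fC p))// ler_norm.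
Qed.

Lemma norm_mul_le (x y : R) : `|x * y| <= x ^+ 2 + y ^+ 2.
Proof.
rewrite normrM -[x ^+ 2]real_normK ?num_real// -[y ^+ 2]real_normK ?num_real//.
by have := sqr_ge0 (`|x| - `|y|); have := sqr_ge0 (`|x| + `|y|); nra.
Qed.

Lemma integrable_mul_gauss2 :
  gauss2.-integrable [set: mR * mR] (EFin \o (fun p => p.1 * p.2)).
Proof.
apply: (@integrable_quadratic 1); first exact: measurable_funM.
by move=> p; rewrite mul1r norm_mul_le.
Qed.

Lemma expect_mul_gauss2 : \E gauss2 (fun p => p.1 * p.2) = 0.
Proof.
have cs : 0 ^+ 2 + 1 ^+ 2 = 1 :> R by ring.
apply: (expect_anti_invariant (transports_rotation_gauss2 cs)
  integrable_mul_gauss2).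
by move=> p; rewrite /rotation /=; ring.
Qed.

Lemma expect_sqr_gauss1_gt0 : 0 < \E gauss1 (fun x : mR => x ^+ 2).
Proof.
apply: expect_gt0 => [||]; first exact: integrable_sqr_gauss1.
  by move=> x; exact: sqr_ge0.
exists [set 0]; split=> [//||x /= /negP].
  by rewrite /gauss1 /= /normal_prob integral_set1.
by rewrite negbK sqrf_eq0 => /eqP.
Qed.

Section correlated_pair.
Variables (rho : R).
Hypothesis rho1 : -1 <= rho <= 1.
Local Notation s := (Num.sqrt (1 - rho ^+ 2)).

Definition corr_fun (p : mR * mR) : mR := rho * p.1 + s * p.2.

Lemma measurable_corr_fun : measurable_fun [set: mR * mR] corr_fun.
Proof. by apply: measurable_funD; exact: measurable_funM. Qed.

Lemma sqr_corr_fun_le p : corr_fun p ^+ 2 <= p.1 ^+ 2 + p.2 ^+ 2.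
Proof.
have -> : p.1 ^+ 2 + p.2 ^+ 2 = corr_fun p ^+ 2 + (s * p.1 - rho * p.2) ^+ 2.
  transitivity ((rho ^+ 2 + s ^+ 2) * (p.1 ^+ 2 + p.2 ^+ 2)).
    by rewrite sqr_sqrt_onem_sqr// subrKC mul1r.
  by rewrite /corr_fun; ring.
by rewrite lerDl sqr_ge0.
Qed.

Definition corr_gap (t : R) (q : mR -> mR) (p : mR * mR) : R :=
  q p.1 * q (corr_fun p) - t * q p.1 ^+ 2.

Lemma measurable_corr_gap t (q : mR -> mR) : measurable_fun [set: mR] q ->
  measurable_fun [set: mR * mR] (corr_gap t q).
Proof.
move=> mq; have mq1 := measurableT_comp mq (@measurable_fst _ _ mR mR).
apply: measurable_funB; last exact/measurable_funM/measurable_funX.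
by apply: measurable_funM => //; exact: measurableT_comp mq measurable_corr_fun.
Qed.

Lemma norm_corr_gap_le t (q : mR -> mR) p : (forall x, `|q x| <= `|x|) ->
  `|corr_gap t q p| <= (2 + `|t|) * (p.1 ^+ 2 + p.2 ^+ 2).
Proof.
move=> q_le; have := sqr_corr_fun_le p; have := sqr_ge0 p.2; move=> p2 Y2.
rewrite (le_trans (ler_normB _ _))// [leRHS]mulrDl lerD//.
  rewrite normrM (le_trans (ler_pM _ _ (q_le _) (q_le _)))// -normrM.
  by rewrite (le_trans (norm_mul_le _ _))//; lra.
rewrite normrM normrX ler_wpM2l//.
rewrite (le_trans (lerXn2r 2 _ _ (q_le p.1))) ?nnegrE//.
by rewrite real_normK ?num_real// lerDl.
Qed.

Lemma expect_corr_gap_id_lt0 t : rho < t -> \E gauss2 (corr_gap t idfun) < 0.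
Proof.
move=> rhot.
have sqrE : \E gauss2 (fun p => p.1 ^+ 2) = \E gauss1 (fun x : mR => x ^+ 2).
  exact: (expect_transports (transports_fst gauss1 gauss1)
    integrable_sqr_gauss1).
rewrite (_ : corr_gap t idfun =
    fun p => s * (p.1 * p.2) - (t - rho) * p.1 ^+ 2).
  rewrite RintegralB//; first last.
  - exact: (integrableZl measurableT (t - rho) integrable_sqr_fst).
  - exact: (integrableZl measurableT s integrable_mul_gauss2).
  rewrite (RintegralZl _ _ integrable_mul_gauss2)// expect_mul_gauss2.
  rewrite mulr0 sub0r (RintegralZl _ _ integrable_sqr_fst)//= sqrE oppr_lt0.
  rewrite mulr_gt0 ?subr_gt0//.
  exact: expect_sqr_gauss1_gt0.
by apply/funext => p; rewrite /corr_gap /corr_fun /=; ring.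
Qed.

Lemma exists_quantizer t : rho < t ->
  exists (K : finType) (kap : mR -> K) (q : K -> R), measurable_fibers kap /\
  \E gauss2 (fun p => q (kap p.1) * q (kap (corr_fun p))) <
  t * \E gauss1 (fun x => q (kap x) ^+ 2).
Proof.
move=> rhot; have [Q [mQ finQ Q_le Q_cvg]] := simple_approximation.
have cvg_gap : \E gauss2 (corr_gap t (Q n)) @[n --> \oo] -->
    \E gauss2 (corr_gap t idfun).
  apply: (expect_dominated
    (g := fun p : mR * mR => (2 + `|t|) * (p.1 ^+ 2 + p.2 ^+ 2))).
  - by move=> n; exact: measurable_corr_gap.
  - by apply: measurable_corr_gap; exact: measurable_id.
  - apply: (@integrable_quadratic (2 + `|t|)).
      apply: measurable_funM => //; apply: measurable_funD;
        exact: measurable_funX.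
    by move=> p; rewrite ger0_norm// mulr_ge0// addr_ge0// sqr_ge0.
  - by move=> n p; exact: norm_corr_gap_le.
  - move=> p; apply: cvgB; first by apply: cvgM; exact: Q_cvg.
    by apply: cvgM; [exact: cvg_cst|apply: cvgM; exact: Q_cvg].
have [n gap_lt0] : exists n, \E gauss2 (corr_gap t (Q n)) < 0.
  have [N _ gap_lt] := cvgr_lt _ cvg_gap _ (expect_corr_gap_id_lt0 rhot).
  by exists N; apply: gap_lt => /=.
have [K [kap [q [mkap QE]]]] := finite_range_factor (mQ n) (finQ n).
exists K, kap, q; split=> //.
have bq : bmeas (fun x : mR => q (kap x)) := bmeas_fibers q mkap.
have bq1 : bmeas (fun p : mR * mR => q (kap p.1)) by apply: (bmeas_comp bq).
have bqY := bmeas_comp bq measurable_corr_fun.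
rewrite -subr_lt0 -(bexpect_fst _ gauss1 (bmeasX 2 bq)).
rewrite -(expectZ _ _ (bmeasX 2 bq1)).
rewrite -(expectB _ (bmeasM bq1 bqY) (bmeasZ t (bmeasX 2 bq1))).
apply: le_lt_trans gap_lt0; rewrite le_eqVlt; apply/orP; left; apply/eqP.
by apply: eq_expect => p; rewrite /corr_gap !QE.
Qed.

End correlated_pair.
End quantization.

Section unit_vector_stability.
Context {R : realType}.
Local Notation V n := (n.-tuple (measurableTypeR R)).

Lemma measurable_unitv n :
  measurable_fun [set: V n.+1] (@unitv R n : V n.+1 -> V n.+1).
Proof.
apply: measurable_fun_ifT; [|exact: measurable_cst|exact: measurable_normalize].
under eq_fun do rewrite normv_eq0.
by apply: measurable_fun_eqr => //; exact: measurable_fun_dotv.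
Qed.

Lemma norm_le_amgm (eta x : R) : 0 < eta -> `|x| <= (eta + eta^-1 * x ^+ 2) / 2.
Proof.
move=> eta0; rewrite -(real_normK (num_real x)) -subr_ge0.
have -> : (eta + eta^-1 * `|x| ^+ 2) / 2 - `|x| = (eta - `|x|) ^+ 2 / (2 * eta).
  by field; rewrite gt_eqF.
by rewrite divr_ge0 ?sqr_ge0// mulr_ge0// ltW.
Qed.

(* With w and z the unit vectors and r, t the norms, <w, z> - <x, y> equals
   <w, z> (1 - r t), and |1 - r t| <= |1 - r^2 t^2|. *)
Lemma dotv_unitv_le n (x y : n.+1.-tuple R) (eta : R) : 0 < eta ->
  dotv (unitv x) (unitv y) <= dotv x y + (eta + (1 + eta^-1) / 2 *
    ((normv x ^+ 2 - 1) ^+ 2 + (normv y ^+ 2 - 1) ^+ 2)).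
Proof.
move=> eta0; rewrite (dotv_polar x y).
have : -1 <= dotv (unitv x) (unitv y) <= 1.
  by apply: dotv_ball_bound; rewrite dotv_unitv_self.
have := normv_ge0 x; have := normv_ge0 y.
move: (normv x) (normv y) => r t t0 r0.
move: (dotv _ _) => c c1; set a := r ^+ 2 - 1; set b := t ^+ 2 - 1.
have rt0 : 0 <= r * t by exact: mulr_ge0.
have diff_le : c * (1 - r * t) <= `|1 - r * t|.
  by rewrite (le_trans (ler_norm _))// normrM ler_piMl// ler_norml.
have norm_sqr_le : `|1 - r * t| <= `|(r * t) ^+ 2 - 1|.
  have -> : (r * t) ^+ 2 - 1 = (r * t - 1) * (r * t + 1) by ring.
  by rewrite normrM distrC ler_peMr// ger0_norm; lra.
have sqrE : (r * t) ^+ 2 - 1 = a * b + a + b by rewrite /a /b; ring.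
have triangle_le : `|a * b + a + b| <= `|a * b| + `|a| + `|b|.
  by rewrite (le_trans (ler_normD _ _))// lerD2r ler_normD.
have ab_le : `|a * b| <= (a ^+ 2 + b ^+ 2) / 2.
  rewrite normrM -(real_normK (num_real a)) -(real_normK (num_real b)).
  by have := sqr_ge0 (`|a| - `|b|); nra.
have := norm_le_amgm a eta0; have := norm_le_amgm b eta0.
by rewrite sqrE in norm_sqr_le; set ie := eta^-1; nra.
Qed.

End unit_vector_stability.

Section concentration.
Context {R : realType}.
Local Notation mR := (measurableTypeR R).
Local Notation V n := (n.-tuple mR).
Variables (q : mR -> R) (n : nat) (rho : R).
Hypotheses (bq : bmeas q) (rho1 : -1 <= rho <= 1).
Local Notation m := (\E gauss1 (fun x => q x ^+ 2)).
Hypothesis m_gt0 : 0 < m.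

Definition rescale (x : V n.+1) : V n.+1 :=
  [tuple (Num.sqrt (n.+1%:R * m))^-1 * q (tnth x i) | i < n.+1].

Definition sqr_deviation (x : mR) : R := m^-1 * q x ^+ 2 - 1.

Lemma measurable_rescale : measurable_fun [set: V n.+1] rescale.
Proof.
apply/measurable_fun_tnthP => i.
rewrite (_ : _ \o _ = fun x =>
  (Num.sqrt (n.+1%:R * m))^-1 * q (tnth x i)); last first.
  by apply/funext => x /=; rewrite tnth_mktuple.
by apply: measurable_funM => //; exact: bmeas_measurable (bmeas_tnth bq i).
Qed.

Lemma dotv_rescale x y : dotv (rescale x) (rescale y) =
  (n.+1%:R * m)^-1 * \sum_(i < n.+1) q (tnth x i) * q (tnth y i).
Proof.
rewrite -[X in X^-1]sqr_sqrtr ?mulr_ge0 ?(ltW m_gt0)// mulr_sumr.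
by apply: eq_bigr => i _; rewrite !tnth_mktuple expr2 invfM mulrACA.
Qed.

Lemma normv_rescale_sqr x : normv (rescale x) ^+ 2 - 1 =
  n.+1%:R^-1 * \sum_(i < n.+1) sqr_deviation (tnth x i).
Proof.
rewrite normv_sqr dotv_rescale sumrB sumr_const card_ord -mulr_sumr.
by rewrite mulrBr mulVf ?pnatr_eq0// invfM mulrA.
Qed.

Lemma bmeas_sqr_deviation : bmeas sqr_deviation.
Proof. exact/bmeasB/bmeas_cst/bmeasZ/bmeasX. Qed.

Lemma expect_sqr_normv_rescale :
  \E (gauss n.+1) (fun x => (normv (rescale x) ^+ 2 - 1) ^+ 2) =
  n.+1%:R^-1 * \E gauss1 (fun x => sqr_deviation x ^+ 2).
Proof.
have bdev := bmeas_sqr_deviation.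
have bsum := bmeasX 2 (bmeas_sum_tnth n.+1 bdev).
have dev0 : \E gauss1 sqr_deviation = 0.
  rewrite expectB; [|exact/bmeasZ/bmeasX|exact: bmeas_cst].
  by rewrite expectZ ?expect_cst ?mulVf ?subrr ?gt_eqF//; exact: bmeasX.
under eq_expect do rewrite normv_rescale_sqr exprMn.
rewrite expectZ// expect_sqr_sum_tnth// mulrA expr2.
by rewrite divfK ?invr_eq0 ?pnatr_eq0.
Qed.

Lemma bmeas_normv_rescale :
  bmeas (fun x : V n.+1 => (normv (rescale x) ^+ 2 - 1) ^+ 2).
Proof.
under eq_fun do rewrite normv_rescale_sqr.
exact/bmeasX/bmeasZ/bmeas_sum_tnth/bmeas_sqr_deviation.
Qed.

Lemma expect_dotv_rescale :
  bmeas (fun p : V n.+1 * V n.+1 => dotv (rescale p.1) (rescale p.2)) /\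
  \E (corr_gauss n.+1 rho) (fun p => dotv (rescale p.1) (rescale p.2)) =
  m^-1 * \E (gauss1 \x gauss1)%E (fun p => q p.1 * q (corr_fun rho p)).
Proof.
have bqq : bmeas (fun p : mR * mR => q p.1 * q p.2).
  by apply: bmeasM; apply: (bmeas_comp bq).
have btnth i :
    bmeas (fun p : V n.+1 * V n.+1 => q (tnth p.1 i) * q (tnth p.2 i)).
  by apply: bmeasM; apply: (bmeas_comp (bmeas_tnth bq i)).
have bsum := bmeas_sum (index_enum 'I_n.+1) btnth.
split; first by under eq_fun do rewrite dotv_rescale; exact: bmeasZ.
under eq_expect do rewrite dotv_rescale.
rewrite expectZ// expect_sum//.
under eq_bigr => i _ do rewrite (expect_corr_gauss_tnth rho i bqq).
rewrite sumr_const card_ord -[X in _ * X]mulr_natl invfM -mulrA mulrCA.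
by rewrite mulKf ?pnatr_eq0.
Qed.

Lemma expect_unitv_rescale_le (eta : R) : 0 < eta ->
  \E (corr_gauss n.+1 rho)
    (fun p => dotv (unitv (rescale p.1)) (unitv (rescale p.2))) <=
  m^-1 * \E (gauss1 \x gauss1)%E (fun p => q p.1 * q (corr_fun rho p)) +
  (eta + (1 + eta^-1) *
    (n.+1%:R^-1 * \E gauss1 (fun x => sqr_deviation x ^+ 2))).
Proof.
move=> eta0; have [bdot dotE] := expect_dotv_rescale.
have bnorm := bmeas_normv_rescale.
have bnorm1 :
    bmeas (fun p : V n.+1 * V n.+1 => (normv (rescale p.1) ^+ 2 - 1) ^+ 2).
  by apply: (bmeas_comp bnorm).
have bnorm2 :
    bmeas (fun p : V n.+1 * V n.+1 => (normv (rescale p.2) ^+ 2 - 1) ^+ 2).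
  by apply: (bmeas_comp bnorm).
have berr := bmeasZ ((1 + eta^-1) / 2) (bmeasD bnorm1 bnorm2).
have beta := bmeas_cst (V n.+1 * V n.+1)%type eta.
apply: le_trans (le_expect _ _ (bmeasD bdot (bmeasD beta berr)) _) _.
- have munit := measurableT_comp (@measurable_unitv R n) measurable_rescale.
  apply: bmeas_dotv => [||p|p]; rewrite ?dotv_unitv_self//.
  + exact: measurableT_comp munit measurable_fst.
  + exact: measurableT_comp munit measurable_snd.
- by move=> p; exact: dotv_unitv_le.
rewrite expectD ?dotE//; last exact: bmeasD.
rewrite expectD// expect_cst expectZ; last exact: bmeasD.
rewrite expectD// (expect_corr_gauss_fst rho bnorm).
rewrite (expect_corr_gauss_snd rho1 bnorm).
rewrite expect_sqr_normv_rescale -mulr2n -[_ * _ *+ 2]mulr_natl.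
by rewrite [_ / 2 * _]mulrA divfK.
Qed.

End concentration.

Section hard_instance.
Context {R : realType}.
Local Notation mR := (measurableTypeR R).
Local Notation V n := (n.-tuple mR).
Variable rho : R.

Lemma expect_corr_fun_sqr (q : mR -> R) : -1 <= rho <= 1 -> bmeas q ->
  \E (gauss1 \x gauss1)%E (fun p => q (corr_fun rho p) ^+ 2) =
  \E gauss1 (fun x => q x ^+ 2).
Proof.
move=> rho1 bq; set s := Num.sqrt (1 - rho ^+ 2).
have cs : rho ^+ 2 + (- s) ^+ 2 = 1 by rewrite sqrrN sqr_sqrt_onem_sqr// subrKC.
have bsqr := bmeasX 2 bq.
have bsqr1 : bmeas (fun p : mR * mR => q p.1 ^+ 2) by apply: (bmeas_comp bsqr).
rewrite -(bexpect_fst _ gauss1 bsqr).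
rewrite -(bexpect_transports (transports_rotation_gauss2 cs) bsqr1).
by apply: eq_expect => p; rewrite /rotation /corr_fun /= mulNr opprK.
Qed.

(* 0 <= E (q(x) + q(y))^2 < 2 (1 + t) E q^2. *)
Lemma quantizer_second_moment_gt0 (q : mR -> R) (t : R) :
  -1 <= rho <= 1 -> rho < t -> bmeas q ->
  \E (gauss1 \x gauss1)%E (fun p => q p.1 * q (corr_fun rho p)) <
  t * \E gauss1 (fun x => q x ^+ 2) ->
  0 < \E gauss1 (fun x => q x ^+ 2).
Proof.
move=> rho1 rhot bq; set r := \E _ _; set m := \E _ _ => rm.
have bq1 : bmeas (fun p : mR * mR => q p.1) by apply: (bmeas_comp bq).
have bqY := bmeas_comp bq (measurable_corr_fun rho).
have : 0 <= m + 2 * r + m.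
  have mE : \E (gauss1 \x gauss1)%E (fun p => q p.1 ^+ 2) = m.
    exact: (bexpect_fst _ gauss1 (bmeasX 2 bq)).
  have mYE : _ = m := expect_corr_fun_sqr rho1 bq.
  rewrite -{1}mE -mYE -expectZ; last exact: bmeasM.
  rewrite -!expectD; do ?[exact: bmeasX|exact/bmeasZ/bmeasM|apply: bmeasD].
  apply: expect_ge0 => p.
  have -> : q p.1 ^+ 2 + 2 * (q p.1 * q (corr_fun rho p)) +
      q (corr_fun rho p) ^+ 2 =
    (q p.1 + q (corr_fun rho p)) ^+ 2 by ring.
  exact: sqr_ge0.
have m0 : 0 <= m by apply: expect_ge0 => x; exact: sqr_ge0.
nra.
Qed.

Lemma exists_unitv_rescale_le (q : mR -> R) (t : R) :
  -1 <= rho <= 1 -> bmeas q -> 0 < \E gauss1 (fun x => q x ^+ 2) ->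
  \E (gauss1 \x gauss1)%E (fun p => q p.1 * q (corr_fun rho p)) <
  t * \E gauss1 (fun x => q x ^+ 2) ->
  exists n, (2 <= n)%N /\
  \E (corr_gauss n.+1 rho)
    (fun p => dotv (unitv (rescale q p.1)) (unitv (rescale q p.2))) <= t.
Proof.
move=> rho1 bq m_gt0; rewrite -ltr_pdivrMr// mulrC.
set r := _^-1 * _ => rt; pose eta := (t - r) / 2.
have eta0 : 0 < eta by rewrite divr_gt0// subr_gt0.
pose C := (1 + eta^-1) * \E gauss1 (fun x => sqr_deviation q x ^+ 2).
have C0 : 0 <= C.
  apply: mulr_ge0; first by rewrite addr_ge0// invr_ge0 ltW.
  by apply: expect_ge0 => x; exact: sqr_ge0.
pose n := (Num.bound (C / eta)).+2; exists n; split=> //.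
have Cn : C / n.+1%:R <= eta.
  rewrite ler_pdivrMr// mulrC -ler_pdivrMr// ltW//.
  apply: lt_le_trans (archi_boundP _) _; first by rewrite divr_ge0// ltW.
  by rewrite ler_nat /n; do 3 apply: leqW.
apply: le_trans (expect_unitv_rescale_le n bq rho1 m_gt0 eta0) _.
rewrite -/r mulrCA -/C [_ * C]mulrC; move: Cn; rewrite /eta.
by move: (C / _) => Cn; lra.
Qed.

Lemma exists_close_partition (t : R) : -1 <= rho <= 1 -> rho < t ->
  exists (n : nat) (W : finType) (cell : V n -> W) (w : W -> n.-tuple R),
  [/\ (3 <= n <= #|W|)%N, measurable_fibers cell, forall v, normv (w v) = 1 &
      \E (corr_gauss n rho) (fun p => dotv (w (cell p.1)) (w (cell p.2))) <= t].
Proof.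
move=> rho1 rhot; have [K [kap [q [mkap q_lt]]]] := exists_quantizer rho1 rhot.
have bq := bmeas_fibers q mkap.
have m_gt0 := quantizer_second_moment_gt0 rho1 rhot bq q_lt.
have [n [n2 unitv_le]] := exists_unitv_rescale_le rho1 bq m_gt0 q_lt.
(* The dummy cells 'I_n.+1 make R^(n.+1) embed in R^#|W|. *)
pose W : finType := (n.+1.-tuple K + 'I_n.+1)%type.
pose cell (x : V n.+1) : W := inl (map_tuple kap x).
pose c := (Num.sqrt (n.+1%:R * \E gauss1 (fun x => q (kap x) ^+ 2)))^-1.
pose g (v : W) : V n.+1 :=
  if v is inl u then [tuple c * q (tnth u i) | i < n.+1]
    else [tuple 0 | i < n.+1].
have gE x : g (cell x) = rescale (fun x => q (kap x)) x.
  by apply: eq_from_tnth => i; rewrite !tnth_mktuple tnth_map.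
exists n.+1, W, cell, (fun v => unitv (g v)); split.
- by rewrite ltnS n2 card_sum card_ord leq_addl.
- exact: (measurable_fibers_comp inl
    (measurable_fibers_map_tuple (n := n.+1) mkap)).
- by move=> v; exact: normv_unitv.
- by under eq_expect do rewrite !gE.
Qed.

Lemma H3_exists_graph_ratio_le (t : R) :
  @H3 R -> -1 <= rho <= 0 -> rho < t < 1 ->
  exists (W : finType) (G : @wgraph R W),
  Prod G / SDP_Prod G <= (1 - Fstar 3 rho) / (1 - t).
Proof.
move=> h3 rho0 /andP[rhot t1]; have rho1 : -1 <= rho <= 1 by lra.
have [n [W [cell [w [/andP[n3 nW] mcell w1 wt]]]]] :=
  exists_close_partition rho1 rhot.
pose P := corr_gauss n rho.
pose L := joint_law P (fun p => cell p.1) (fun p => cell p.2).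
have [mcell1 mcell2] : measurable_fibers (fun p : V n * V n => cell p.1) /\
    measurable_fibers (fun p : V n * V n => cell p.2).
  by split=> v; [exact: measurable_preimage measurable_fst (mcell v)|
                 exact: measurable_preimage measurable_snd (mcell v)].
have sepE d (f : W -> d.-tuple R) : (forall v, normv (f v) = 1) ->
    separation L f = 1 - \E P (fun p => dotv (f (cell p.1)) (f (cell p.2))).
  move=> f1; have mf : measurable_fun [set: V n] (f \o cell : V n -> V d).
    exact: measurable_fun_fibers.
  rewrite /separation
    (sum_joint_law P mcell1 mcell2 (fun u v => 1 - dotv (f u) (f v))).
  rewrite expectB ?expect_cst//; first exact: bmeas_cst.
  by apply: bmeas_dotv => [||p|p]; rewrite -?normv_le1 ?f1//;
    [exact: measurableT_comp mf measurable_fst|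
     exact: measurableT_comp mf measurable_snd].
exists W; apply: (@exists_graph_ratio_le _ _ L n w) => //.
- exact: joint_law_ge0.
- by rewrite subr_gt0.
- by rewrite sepE// lerD2l lerN2.
move=> f f1; rewrite sepE// lerD2l lerN2 -(Stab_fopt3 rho n3).
have mf : measurable_fun [set: V n] (f \o cell : V n -> V 3).
  exact: measurable_fun_fibers.
rewrite (le_trans (h3 n n3 rho rho0 (f \o cell) mf _))// => [x|].
  by rewrite f1.
by rewrite StabE// => x; rewrite -normv_le1 f1.
Qed.

End hard_instance.

Section infimum.
Context {R : realType}.
Hypothesis h3 : @H3 R.
Implicit Types rho t : R.

Lemma ratios_lbound : lbound (@ratios R) alpha_BOV.
Proof. by move=> _ [V [G ->]]; exact: alpha_BOV_le_ratio. Qed.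

Lemma inf_ratios_le_gap rho t : -1 <= rho <= 0 -> rho < t < 1 ->
  inf (@ratios R) <= (1 - Fstar 3 rho) / (1 - t).
Proof.
move=> rho0 rhot; have [V [G GE]] := H3_exists_graph_ratio_le h3 rho0 rhot.
apply: le_trans GE; apply: ge_inf; last by exists V, G.
by exists alpha_BOV; exact: ratios_lbound.
Qed.

Lemma ratios_nonempty : @ratios R !=set0.
Proof.
have [||V [G _]] := @H3_exists_graph_ratio_le R 0 2^-1 h3; [by lra..|].
by exists (Prod G / SDP_Prod G), V, G.
Qed.

Lemma inf_ratios_ge0 : 0 <= inf (@ratios R).
Proof.
apply: le_trans (@alpha_BOV_ge0 R) _.
exact: lb_le_inf ratios_nonempty ratios_lbound.
Qed.

Lemma inf_ratios_le rho : -1 <= rho <= 0 ->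
  inf (@ratios R) <= (1 - Fstar 3 rho) / (1 - rho).
Proof.
move=> rho0; have rho1 : 0 < 1 - rho by lra.
have I0 := inf_ratios_ge0; have F1 := Fstar_le1 3 rho.
rewrite ler_pdivlMr// leNgt; apply/negP; move: I0; set I := inf _ => I0 F_lt.
have Igt0 : 0 < I.
  by rewrite lt_neqAle I0 andbT eq_sym; apply: contraTneq F_lt => ->; lra.
pose t := (1 - (1 - Fstar 3 rho) / I + rho) / 2.
have quot_lt : (1 - Fstar 3 rho) / I < 1 - rho by rewrite ltr_pdivrMr// mulrC.
have quot_ge0 : 0 <= (1 - Fstar 3 rho) / I by rewrite divr_ge0// subr_ge0.
have /inf_ratios_le_gap : rho < t < 1 by rewrite /t; lra.
move=> /(_ rho0); rewrite -/I ler_pdivlMr ?subr_gt0; last by rewrite /t; lra.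
by rewrite leNgt mulrC -ltr_pdivrMr// /t; lra.
Qed.

Lemma inf_ratios_le1 : inf (@ratios R) <= 1.
Proof.
have /inf_ratios_le : -1 <= (0 : R) <= 0 by lra.
by have := @Fstar0_ge0 R 3; rewrite subr0 divr1; lra.
Qed.

End infimum.

Theorem theorem2p8 (R : realType) :
  @H3 R -> inf (@ratios R) = @alpha_BOV R.
Proof.
move=> h3; apply/eqP; rewrite eq_le; apply/andP; split; last first.
  exact: lb_le_inf (ratios_nonempty h3) (@ratios_lbound R).
apply: lb_le_inf; first by exists ((1 - Fstar 3 0) / (1 - 0)), 0 => //=; lra.
move=> _ [rho /= /andP[rho0 rho1] <-].
have [rho_le0|rho_gt0] := leP rho 0.
  by apply: inf_ratios_le; rewrite ?rho0.
apply: le_trans (inf_ratios_le1 h3) _.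
rewrite ler_pdivlMr ?subr_gt0// mul1r lerD2l lerN2.
by apply: Fstar_le_id; rewrite !ltW.
Qed.
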